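(* Let $x\in\mathbb{R}^m$ be a random variable with Gaussian distribution $x\sim\mathbf{N}(0,\Sigma)$, and let $\theta:\mathbb{R}^m\to\mathbb{R}^m$ be an analytic nonlinear function satisfying $\theta(0)=0$. Assume that the covariance $\Sigma_\theta=\mathbb{E}[\theta(x)\theta(x)^\top]$ of $\theta(x)$ is well-defined. Then $$\Sigma_\theta = \left(\mathrm{D}_z|_0\theta(z)\right)\,\Sigma\,\left(\mathrm{D}_z|_0\theta(z)\right)^\top + \mathbf{O}(\mathrm{tr}(\Sigma^2)).$$
   Context: $\mathrm{D}_z|_0\theta(z)$ is the $m\times m$ Jacobian matrix of $\theta$ at $0$. $\mathbf{N}(0,\Sigma)$ is the zero-mean Gaussian on $\mathbb{R}^m$ with positive-definite covariance $\Sigma$. The notation $\mathbf{O}(\mathrm{tr}(\Sigma^2))$ is an asymptotic statement for fixed $\theta$ as $\Sigma\to0$: the error matrix has norm bounded by a constant times $\mathrm{tr}(\Sigma^2)$ for all sufficiently small $\Sigma$.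
   Formalization: With one constant for all small Σ the claim fails for m≥2 if Σ_θ is only well-defined; proved instead: uniformly over small Σ of bounded condition number, and over all small positive-definite Σ when Σ_θ is also bounded near Σ=0 (a necessary condition). *)

(* Defs.v *)
From HB Require Import structures.
From mathcomp Require Import all_boot all_order all_algebra.
From mathcomp Require Import all_classical all_reals all_analysis.
Set Implicit Arguments.
Unset Strict Implicit.
Unset Printing Implicit Defensive.
Import Order.TTheory GRing.Theory Num.Theory.
Import numFieldNormedType.Exports.
Local Open Scope classical_set_scope.
Local Open Scope ring_scope.

(* Monomial h^a for the multi-index a. *)
Definition monomial (R : realType) (m : nat) (h : 'cV[R]_m)
    (a : {ffun 'I_m -> nat}) : R :=
  \prod_(i < m) h i 0 ^+ a i.

(* Partial sum over the box of the multi-indices whose entries are all < n. *)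
Definition box_sum (R : realType) (m : nat) (F : {ffun 'I_m -> nat} -> R)
    (n : nat) : R :=
  \sum_(a : {ffun 'I_m -> 'I_n}) F [ffun i => nat_of_ord (a i)].

(* The multi-indexed power series with coefficients c converges absolutely to
   f (a + h) for every h in a neighbourhood of 0. Because of the absolute
   convergence, summing along boxes gives the unordered sum. *)
Definition analytic_at (R : realType) (m : nat) (f : 'cV[R]_m -> R)
    (a : 'cV[R]_m) : Prop :=
  exists c : {ffun 'I_m -> nat} -> R,
    \forall h \near (0 : 'cV[R]_m),
      cvgn (box_sum (fun k => `|c k * monomial h k|)) /\
      box_sum (fun k => c k * monomial h k) @ \oo --> f (a + h).

Definition analytic (R : realType) (m : nat)
    (f : 'cV[R]_m -> 'cV[R]_m) : Prop :=
  forall (a : 'cV[R]_m) (i : 'I_m), analytic_at (fun z => f z i 0) a.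

(* The library's [jacobian] is for row vectors and acts on the right; this is
   the usual matrix of partial derivatives d f_i / d z_j acting on columns. *)
Definition jacobian_cV (R : realType) (m : nat)
    (f : 'cV[R]_m -> 'cV[R]_m) (a : 'cV[R]_m) : 'M[R]_m :=
  \matrix_(i < m, j < m) 'D_(delta_mx j 0) (fun z => f z i 0) a.

Definition posdef (R : realType) (m : nat) (S : 'M[R]_m) : Prop :=
  S^T = S /\ forall v : 'cV[R]_m, v != 0 -> 0 < (v^T *m S *m v) 0 0.

(* For the whole (finite) family, independence of every subfamily is obtained
   by taking some of the B i to be setT. *)
Definition independent_RVs (R : realType) (m : nat) (d : measure_display)
    (T : measurableType d) (P : probability T R)
    (Z : 'I_m -> {RV P >-> R}) : Prop :=
  forall B : 'I_m -> set R, (forall i, measurable (B i)) ->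
    P (\bigcap_(i in [set: 'I_m]) (Z i @^-1` B i)) =
    (\prod_(i < m) P (Z i @^-1` B i))%E.

Definition standard_normals (R : realType) (m : nat) (d : measure_display)
    (T : measurableType d) (P : probability T R)
    (Z : 'I_m -> {RV P >-> R}) : Prop :=
  independent_RVs Z /\
  forall (i : 'I_m) (B : set R), measurable B ->
    distribution P (Z i) B = normal_prob 0 1 B.

(* X ~ N(0, S): X is a linear image A Z of a vector Z of independent standard
   normal variables, with A A^T = S. For S positive definite, A is invertible,
   so taking A square and Z on the same probability space is no restriction. *)
Definition gaussian_vector (R : realType) (m : nat) (d : measure_display)
    (T : measurableType d) (P : probability T R) (S : 'M[R]_m)
    (X : T -> 'cV[R]_m) : Prop :=
  exists (A : 'M[R]_m) (Z : 'I_m -> {RV P >-> R}),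
    [/\ A *m A^T = S, standard_normals Z &
        forall w, X w = A *m \col_(i < m) Z i w].

(* The covariance of Y is E[Y Y^T], without centering, as in the source. *)
Definition covariance_well_defined (R : realType) (m : nat)
    (d : measure_display) (T : measurableType d) (P : probability T R)
    (Y : T -> 'cV[R]_m) : Prop :=
  forall i j : 'I_m,
    P.-integrable [set: T] (EFin \o (fun w => (Y w *m (Y w)^T) i j)).

Definition covariance_mx (R : realType) (m : nat)
    (d : measure_display) (T : measurableType d) (P : probability T R)
    (Y : T -> 'cV[R]_m) : 'M[R]_m :=
  \matrix_(i < m, j < m) fine ('E_P[fun w => (Y w *m (Y w)^T) i j])%E.

(* Sigma_theta = (D theta(0)) Sigma (D theta(0))^T + O(tr(Sigma^2)) as
   Sigma -> 0 through the positive-definite matrices of the set K: one constant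
   and one neighbourhood of 0 serve all these Sigma. *)
Definition covariance_expansion_on (R : realType) (m : nat)
    (theta : 'cV[R]_m -> 'cV[R]_m) (K : set 'M[R]_m) : Prop :=
  exists C : R, \forall S \near (0 : 'M[R]_m), K S -> posdef S ->
    forall (d : measure_display) (T : measurableType d) (P : probability T R)
      (x : T -> 'cV[R]_m),
      gaussian_vector P S x -> covariance_well_defined P (theta \o x) ->
      `|covariance_mx P (theta \o x)
          - jacobian_cV theta 0 *m S *m (jacobian_cV theta 0)^T|
      <= C * \tr (S *m S).

(* tr(S) I <= kappa S in the Loewner order: for S positive definite this bounds
   the condition number of S (by kappa), and conversely a condition number at
   most k gives this bound with kappa = m k. *)
Definition well_conditioned (R : realType) (m : nat) (kappa : R)
    (S : 'M[R]_m) : Prop :=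
  forall v : 'cV[R]_m,
    \tr S * (v^T *m v) 0 0 <= kappa * (v^T *m S *m v) 0 0.

(* Sigma_theta is well-defined, and bounded as a function of Sigma, on a
   neighbourhood of 0 in the positive-definite matrices. The boundedness is
   necessary for an expansion that is uniform over all small Sigma; finiteness
   for each Sigma does not imply it. With m = 2, E = exp(z1^4) and
   theta(z) = (E exp(- z2^2 E^4) - 1, 0), Sigma_theta is finite for every
   positive-definite Sigma, but unbounded when Sigma = diag(e, d), d -> 0. *)
Definition covariance_bounded_near0 (R : realType) (m : nat)
    (theta : 'cV[R]_m -> 'cV[R]_m) : Prop :=
  exists M : R, \forall S \near (0 : 'M[R]_m), posdef S ->
    forall (d : measure_display) (T : measurableType d) (P : probability T R)
      (x : T -> 'cV[R]_m),
      gaussian_vector P S x ->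
      covariance_well_defined P (theta \o x) /\
      `|covariance_mx P (theta \o x)| <= M.

(* Main.v *)
Require Import Defs.
From HB Require Import structures.
From mathcomp Require Import all_boot all_order all_algebra.
From mathcomp Require Import all_classical all_reals all_analysis.
From mathcomp Require Import measurable_realfun ring lra.
Import Order.TTheory GRing.Theory Num.Theory.
Import numFieldNormedType.Exports.
Local Open Scope classical_set_scope.
Local Open Scope ring_scope.
Set Implicit Arguments.
Unset Strict Implicit.
Unset Printing Implicit Defensive.

(* Write x = A Z with Z a standard Gaussian vector and A A^T = S. Near 0 the
   even part of theta is O(|x|^2) and its odd part is D x + O(|x|^3), so the
   symmetrization of theta theta^T under x -> -x equals (D x)(D x)^T up to
   O(|x|^4), and E|x|^4 = O(tr(S)^2) = O(tr(S^2)).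

   The region |x|^2 > rho must contribute O(tr(S)^2) as well, although theta may
   grow fast. There the density of N(0, S) is compared with that of another
   centred Gaussian for which E|theta|^2 is controlled: in the well-conditioned
   case any fixed N(0, S0) for which the covariance of theta is well-defined (if
   there is none, nothing has to be proved), in the bounded case N(0, c^2 S)
   with c^2 of order 1 / tr(S). The ratio of the densities is at most
   G tr(S)^-m exp(- rho / (4 tr(S))), which decays faster than any power of
   tr(S).

   The comparison of Gaussian laws under linear maps avoids determinants: the
   law of B Z reweighted by e^{|Z|^2/2} is translation invariant, hence, by the
   usual Fubini proof of the uniqueness of Haar measure, proportional to the
   reweighted law of Z. *)

(** * Transfer of nonnegative integrals *)

(** The obstacle is the tail. The smallness has to come from the law of x alone: under a wider
    Gaussian with controlled second moment of [theta], the density ratio itself is the small factor.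
    The 4 in its exponent arises because half of the Gaussian exponent |x|^2 / (2 tr(S)) is spent on
    absorbing the exponent of the comparison law. One tool feeds all Gaussian computations, the
    coordinatewise change of variable z -> c z + a: a constant integrand yields exponential moments,
    c of modulus 1 the reflections, c = 1 the translations. Laws are handled as a weight and a map
    on the underlying space, so that variables on different probability spaces can be compared
    directly. *)

Section transfer.
Local Open Scope ereal_scope.
Import HBNNSimple.

Lemma ge0_integral_weighted_nnsfun (R : realType) d (T : measurableType d)
    d' (X : measurableType d') (mu : {measure set T -> \bar R})
    (w : T -> R) (f : T -> X) (h : {nnsfun X >-> R}) :
  measurable_fun [set: T] w -> (forall x, 0 <= w x)%R ->
  measurable_fun [set: T] f ->
  \int[mu]_x ((w x)%:E * (h (f x))%:E) =
  \sum_(r \in range h)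
    r%:E * \int[mu]_x ((w x)%:E * (\1_(h @^-1` [set r]) (f x))%:E).
Proof.
move=> mw w0 mf.
under eq_integral => x _.
  rewrite fimfunE -fsumEFin// ge0_mule_fsumr; last first.
    by move=> r; rewrite EFinM nnfun_muleindic_ge0.
  over.
rewrite ge0_integral_fsum//; last 2 first.
- move=> r; apply/measurable_EFinP; apply: measurable_funM => //.
  by apply: measurable_funM => //; apply: measurableT_comp.
- by move=> r x _; rewrite mule_ge0 ?lee_fin// -lee_fin EFinM nnfun_muleindic_ge0.
apply: eq_fsbigr => r /[!inE] -[x _ <-].
under eq_integral do rewrite EFinM muleCA.
rewrite ge0_integralZl//.
- apply/measurable_EFinP; apply: measurable_funM => //.
  by apply: measurableT_comp.
- by move=> y _; rewrite mule_ge0// lee_fin.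
- by rewrite lee_fin.
Qed.

(** Indicators, then simple functions, then monotone convergence. The weighted laws are not turned
    into measures: their values on measurable sets suffice, and [w1], [w2] later carry densities,
    products of other factors or constants. *)
Lemma ge0_integral_transfer (R : realType) d1 (T1 : measurableType d1)
    d2 (T2 : measurableType d2) d (X : measurableType d)
    (mu1 : {measure set T1 -> \bar R}) (mu2 : {measure set T2 -> \bar R})
    (w1 : T1 -> R) (w2 : T2 -> R) (f1 : T1 -> X) (f2 : T2 -> X)
    (g : X -> \bar R) :
  measurable_fun [set: T1] w1 -> (forall x, 0 <= w1 x)%R ->
  measurable_fun [set: T2] w2 -> (forall x, 0 <= w2 x)%R ->
  measurable_fun [set: T1] f1 -> measurable_fun [set: T2] f2 ->
  measurable_fun [set: X] g -> (forall x, 0 <= g x) ->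
  (forall B, measurable B -> \int[mu1]_x ((w1 x)%:E * (\1_B (f1 x))%:E) =
                             \int[mu2]_x ((w2 x)%:E * (\1_B (f2 x))%:E)) ->
  \int[mu1]_x ((w1 x)%:E * g (f1 x)) = \int[mu2]_x ((w2 x)%:E * g (f2 x)).
Proof.
move=> mw1 w10 mw2 w20 mf1 mf2 mg g0 eqB.
pose h := nnsfun_approx measurableT mg.
have key d0 (T : measurableType d0) (mu : {measure set T -> \bar R})
    (w : T -> R) (f : T -> X) : measurable_fun [set: T] w ->
    (forall x, 0 <= w x)%R -> measurable_fun [set: T] f ->
    \int[mu]_x ((w x)%:E * (h n (f x))%:E) @[n --> \oo] -->
    \int[mu]_x ((w x)%:E * g (f x)).
  move=> mw w0 mf.
  rewrite (_ : (fun x => _) =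
               (fun x => limn (fun n => (w x)%:E * (h n (f x))%:E))).
    apply: cvg_monotone_convergence => //.
    - move=> n; apply/measurable_EFinP/measurable_funM => //.
      exact: measurableT_comp.
    - by move=> n x _; rewrite mule_ge0// lee_fin.
    - move=> x _ a b ab; rewrite lee_wpmul2l ?lee_fin//.
      exact/lefP/nd_nnsfun_approx.
  apply/funext => x; apply/esym/cvg_lim => //.
  by apply: cvgeZl => //; exact: cvg_nnsfun_approx.
have k1 := key _ _ mu1 _ _ mw1 w10 mf1.
have k2 := key _ _ mu2 _ _ mw2 w20 mf2.
rewrite -(cvg_lim (@ereal_hausdorff R) k1) -(cvg_lim (@ereal_hausdorff R) k2).
congr (limn _); apply: funext => n.
rewrite !ge0_integral_weighted_nnsfun//.
apply: eq_fsbigr => r _ /=; congr (_ * _); exact: eqB.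
Qed.

End transfer.

(** * Affine changes of variable for the standard normal law *)

Section affine_change.
Local Open Scope ereal_scope.

Lemma measurable_affine (R : realType) (c a : R) :
  measurable_fun [set: R] (fun z : R => c * z + a)%R.
Proof. by apply: measurable_funD => //; apply: measurable_funM. Qed.

Lemma lebesgue_measure_affine (R : realType) (c a : R) (A : set R) :
  c != 0%R -> measurable A ->
  lebesgue_measure A =
  `|c|%:E * lebesgue_measure ((fun z : R => c * z + a)%R @^-1` A).
Proof.
move=> c0 mA.
pose phi (z : measurableTypeR R) : measurableTypeR R := (c * z + a)%R.
have mphi : measurable_fun [set: measurableTypeR R] phi.
  exact: measurable_affine.
pose mu := mscale (NngNum (normr_ge0 c))
  (measure_function_pushforward__canonical__measure_function_Measure
    lebesgue_measure mphi).
rewrite (@lebesgue_measure_unique R mu)// => _ [[u v] _ <-] /=.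
rewrite /mu /mscale /= /pushforward /phi.
case: (ltgtP c 0%R) c0 => // [cN|cP] _.
(* A negative slope moves the closed end of the half-open interval to the other side; the length is
   not affected. *)
- rewrite (_ : _ @^-1` _ = `[((v - a) / c)%R, ((u - a) / c)%R[%classic); last first.
    apply/seteqP; split => z /=; rewrite !in_itv/=.
      by rewrite ler_ndivrMr// ltr_ndivlMr// lerBrDr ltrBlDr ![(z * c)%R]mulrC andbC.
    by rewrite ler_ndivrMr// ltr_ndivlMr// lerBrDr ltrBlDr ![(z * c)%R]mulrC andbC.
  rewrite !lebesgue_measure_itv/= !lte_fin ltr_ndivrMr// divfK ?lt_eqF// ltrD2r.
  case: ifP => uv; last by rewrite mule0.
  rewrite -!EFinB -EFinM ltr0_norm//; congr EFin; field; exact: ltr0_neq0.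
- rewrite (_ : _ @^-1` _ = `]((u - a) / c)%R, ((v - a) / c)%R]%classic); last first.
    apply/seteqP; split => z /=; rewrite !in_itv/=.
      by rewrite ltr_pdivrMr// ler_pdivlMr// lerBrDr ltrBlDr ![(z * c)%R]mulrC.
    by rewrite ltr_pdivrMr// ler_pdivlMr// lerBrDr ltrBlDr ![(z * c)%R]mulrC.
  rewrite !lebesgue_measure_itv/= !lte_fin ltr_pdivrMr// divfK ?gt_eqF// ltrD2r.
  case: ifP => uv; last by rewrite mule0.
  rewrite -!EFinB -EFinM gtr0_norm//; congr EFin; field; exact: lt0r_neq0.
Qed.

Lemma ge0_integral_affine (R : realType) (c a : R) (g : R -> \bar R) :
  c != 0%R -> measurable_fun [set: R] g -> (forall x, 0 <= g x) ->
  \int[lebesgue_measure]_x g x =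
  \int[lebesgue_measure]_x (`|c|%:E * g (c * x + a)%R).
Proof.
move=> c0 mg g0.
under eq_integral do rewrite -[g _]mul1e.
have H := @ge0_integral_transfer R _ (measurableTypeR R) _ (measurableTypeR R)
  _ R lebesgue_measure lebesgue_measure
  (cst 1%R) (cst `|c|%R) (fun x => x) (fun x => (c * x + a)%R) g.
apply: H => //.
  exact: measurable_affine.
move=> B mB.
have mpre : measurable ((fun z : R => c * z + a)%R @^-1` B).
  by rewrite -[X in measurable X]setTI; apply: measurable_affine.
under eq_integral do rewrite mul1e.
rewrite integral_indic// setIT [RHS]/= ge0_integralZl//.
- apply: etrans (lebesgue_measure_affine a c0 mB) _; congr (_ * _).
  rewrite -[LHS](congr1 _ (setIT _)); exact/esym/integral_indic.
- apply/measurable_EFinP; apply: measurableT_comp => //; exact: measurable_affine.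
Qed.

End affine_change.

Section normal.
Local Open Scope ereal_scope.
Context (R : realType).
Implicit Types (d : measure_display).

Definition std_normal d (T : measurableType d) (P : probability T R)
    (Z : {RV P >-> R}) :=
  forall B : set R, measurable B -> distribution P Z B = normal_prob 0 1 B.

Lemma expectation_std_normal d (T : measurableType d) (P : probability T R)
    (Z : {RV P >-> R}) (g : R -> \bar R) :
  std_normal Z -> measurable_fun [set: R] g -> (forall x, 0 <= g x) ->
  \int[P]_w g (Z w) = \int[lebesgue_measure]_x ((normal_pdf 0 1 x)%:E * g x).
Proof.
move=> NZ mg g0.
under eq_integral do rewrite -[g _]mul1e.
have H := @ge0_integral_transfer R _ T _ (measurableTypeR R)
  _ R P lebesgue_measure
  (cst 1%R) (normal_pdf 0 1)%R Z (fun x => x) g.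
apply: H => //.
- exact: measurable_normal_pdf.
- by move=> x; exact: normal_pdf_ge0.
- move=> B mB; under eq_integral do rewrite mul1e.
  have mpre : measurable (Z @^-1` B).
    by rewrite -[X in measurable X]setTI; exact: measurable_funP.
  transitivity (P (Z @^-1` B)).
    by rewrite -[in RHS](setIT (_ @^-1` B)) -integral_indic.
  apply: etrans (NZ B mB) _; rewrite /normal_prob.
  rewrite [LHS]integral_mkcond. apply: eq_integral => x _.
  by rewrite patchE indicE; case: ifPn => _; rewrite ?mule1 ?mule0.
Qed.

(* |c| phi(c z + a) / phi(z) for the standard normal density phi. *)
Definition affine_weight (c a z : R) : R :=
  (`|c| * expR ((z ^+ 2 - (c * z + a) ^+ 2) / 2))%R.

Lemma affine_weight_ge0 c a z : (0 <= affine_weight c a z)%R.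
Proof. by rewrite mulr_ge0// expR_ge0. Qed.

Lemma measurable_affine_weight c a :
  measurable_fun [set: R] (affine_weight c a).
Proof.
apply: measurable_funM => //; apply: measurableT_comp => //.
apply: measurable_funM => //; apply: measurable_funB; first exact: measurable_funX.
by apply: measurable_funX; exact: measurable_affine.
Qed.

(** Both sides reduce to one Lebesgue integral, which is why [Z] and [Z'] may live on different
    spaces; the normalizing constant of the density cancels. *)
Lemma std_normal_affine_change d (T : measurableType d) (P : probability T R)
    (Z : {RV P >-> R}) d' (T' : measurableType d') (P' : probability T' R)
    (Z' : {RV P' >-> R}) (c a : R) (g : R -> \bar R) :
  std_normal Z -> std_normal Z' -> c != 0%R ->
  measurable_fun [set: R] g -> (forall x, 0 <= g x) ->
  \int[P]_w g (Z w) =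
  \int[P']_w ((affine_weight c a (Z' w))%:E * g (c * Z' w + a)%R).
Proof.
move=> NZ NZ' c0 mg g0.
rewrite (expectation_std_normal NZ)//.
rewrite (@expectation_std_normal _ _ _ Z'
  (fun z => (affine_weight c a z)%:E * g (c * z + a)%R))//; last 2 first.
- apply: emeasurable_funM.
    by apply/measurable_EFinP; exact: measurable_affine_weight.
  by apply: measurableT_comp => //; exact: measurable_affine.
- by move=> x; rewrite mule_ge0 ?lee_fin ?affine_weight_ge0.
rewrite (@ge0_integral_affine _ c a)//; last 2 first.
- apply: emeasurable_funM => //; apply/measurable_EFinP; exact: measurable_normal_pdf.
- by move=> x; rewrite mule_ge0 ?lee_fin ?normal_pdf_ge0.
apply: eq_integral => x _; rewrite !muleA; congr (_ * _).
rewrite -!EFinM; congr EFin.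
rewrite /normal_pdf oner_eq0 /normal_fun /affine_weight !subr0 expr1n.
rewrite mulrCA -[RHS]mulrA; congr (_ * _)%R.
rewrite [RHS]mulrCA; congr (_ * _)%R.
by rewrite -expRD; congr expR; field.
Qed.

End normal.

(** * Product sigma-algebra of tuples *)

Section pi_system.
Local Open Scope ereal_scope.

Lemma integral_weighted_indic (R : realType) d (T : measurableType d)
    d' (X : measurableType d') (mu : {measure set T -> \bar R})
    (w : T -> R) (f : T -> X) (B : set X) :
  \int[mu]_x ((w x)%:E * (\1_B (f x))%:E) = \int[mu]_(x in f @^-1` B) (w x)%:E.
Proof.
rewrite [RHS]integral_mkcond; apply: eq_integral => x _.
rewrite patchE indicE; have [Bx|Bx] := boolP (f x \in B).
  by rewrite mule1 mem_set//; exact: set_mem Bx.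
by rewrite mule0 ifF//; apply/negbTE; apply: contra Bx => /set_mem/mem_set.
Qed.

(** Dynkin's pi-lambda argument for weighted laws. Complements require subtraction from the total
    mass, hence the finiteness assumption; it passes to the second side because [setT] belongs to
    [G]. *)
Lemma integral_weighted_pi_system (R : realType) d1 (T1 : measurableType d1)
    d2 (T2 : measurableType d2) d (X : measurableType d)
    (mu1 : {measure set T1 -> \bar R}) (mu2 : {measure set T2 -> \bar R})
    (w1 : T1 -> R) (w2 : T2 -> R) (f1 : T1 -> X) (f2 : T2 -> X)
    (G : set (set X)) :
  measurable_fun [set: T1] w1 -> (forall x, 0 <= w1 x)%R ->
  measurable_fun [set: T2] w2 -> (forall x, 0 <= w2 x)%R ->
  measurable_fun [set: T1] f1 -> measurable_fun [set: T2] f2 ->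
  @measurable _ X = <<s G >> -> setI_closed G -> G setT ->
  \int[mu1]_x (w1 x)%:E < +oo ->
  (forall B, G B -> \int[mu1]_(x in f1 @^-1` B) (w1 x)%:E =
                    \int[mu2]_(x in f2 @^-1` B) (w2 x)%:E) ->
  (forall B, measurable B -> \int[mu1]_(x in f1 @^-1` B) (w1 x)%:E =
                    \int[mu2]_(x in f2 @^-1` B) (w2 x)%:E).
Proof.
move=> mw1 w10 mw2 w20 mf1 mf2 GE GI GT fin eqG B.
have mpre1 A : measurable A -> measurable (f1 @^-1` A).
  by move=> mA; rewrite -[X in measurable X]setTI; exact: mf1.
have mpre2 A : measurable A -> measurable (f2 @^-1` A).
  by move=> mA; rewrite -[X in measurable X]setTI; exact: mf2.
have mw1' A : measurable_fun A (EFin \o w1).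
  by apply: measurable_funTS; exact/measurable_EFinP.
have mw2' A : measurable_fun A (EFin \o w2).
  by apply: measurable_funTS; exact/measurable_EFinP.
rewrite GE; move: B; apply: (@dynkin_induction _ _ G (fun S =>
  \int[mu1]_(x in f1 @^-1` S) (w1 x)%:E =
  \int[mu2]_(x in f2 @^-1` S) (w2 x)%:E) GE GI) => //; first exact: eqG.
- move=> S mS eqS.
  have splitS d0 (T : measurableType d0) (mu : {measure set T -> \bar R})
      (w : T -> R) (f : T -> X) : measurable_fun [set: T] w ->
      (forall x, 0 <= w x)%R -> measurable_fun [set: T] f ->
      \int[mu]_x (w x)%:E = \int[mu]_(x in f @^-1` S) (w x)%:E
                          + \int[mu]_(x in f @^-1` (~` S)) (w x)%:E.
    move=> mw w0 mf.
    have mpre A : measurable A -> measurable (f @^-1` A).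
      by move=> mA; rewrite -[X in measurable X]setTI; exact: mf.
    rewrite -ge0_integral_setU//=.
    + by rewrite -preimage_setU setUv preimage_setT.
    + exact: mpre.
    + by apply: mpre; exact: measurableC.
    + by apply: measurable_funTS; exact/measurable_EFinP.
    + by move=> x _; rewrite lee_fin.
    + by apply/disj_setPS => x [].
  have := splitS _ _ mu1 _ _ mw1 w10 mf1.
  have := splitS _ _ mu2 _ _ mw2 w20 mf2.
  have := eqG _ GT; rewrite !preimage_setT => <- ->.
  rewrite -eqS => E.
  have Sfin : \int[mu1]_(x in f1 @^-1` S) (w1 x)%:E \is a fin_num.
    rewrite ge0_fin_numE; last by apply: integral_ge0 => x _; rewrite lee_fin.
    apply: le_lt_trans fin; apply: ge0_subset_integral => //; first exact: mpre1.
    by move=> x _; rewrite lee_fin.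
  rewrite -[LHS](addeK _ Sfin) -[RHS](addeK _ Sfin); congr (_ - _).
  by rewrite addeC -E addeC.
- move=> F mF tF eqF.
  have trivIset_pre (T : Type) (f : T -> X) :
      trivIset setT (fun k => f @^-1` F k).
    apply/trivIsetP => i j _ _ ij; rewrite -preimage_setI.
    by move/trivIsetP : tF => /(_ _ _ _ _ ij) ->//; rewrite preimage_set0.
  rewrite !preimage_bigcup !ge0_integral_bigcup//.
  + by apply: eq_eseriesr => n _; exact: eqF.
  + by move=> n; apply: mpre2.
  + by move=> x _; rewrite lee_fin.
  + by move=> n; apply: mpre1.
  + by move=> x _; rewrite lee_fin.
Qed.

End pi_system.

Section boxes.
Local Open Scope ereal_scope.
Context (R : realType) (m : nat).

Definition boxes : set (set (m.-tuple R)) :=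
  [set A | exists2 B : 'I_m -> set R, (forall i, measurable (B i)) &
             A = [set t | forall i, B i (tnth t i)]].

Lemma boxes_setI : setI_closed boxes.
Proof.
move=> _ _ [B mB ->] [B' mB' ->]; exists (fun i => B i `&` B' i).
  by move=> i; exact: measurableI.
by apply/seteqP; split => [t [h h'] i|t h] //; split => i; case: (h i).
Qed.

Lemma boxesT : boxes setT.
Proof. by exists (fun=> setT) => //; apply/seteqP; split. Qed.

Lemma measurable_tuple_boxes : @measurable _ (m.-tuple R) = <<s boxes >>.
Proof.
apply/seteqP; split.
  apply: smallest_sub; first exact: smallest_sigma_algebra.
  move=> A; rewrite -bigcup_seq => -[/= i _ [B mB <-]].
  apply: sub_sigma_algebra; exists (fun j => if j == i then B else setT).
    by move=> j; case: ifP.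
  rewrite setTI; apply/seteqP; split => [t Bt j|t /(_ i)]; rewrite ?eqxx//.
  by case: ifPn => // /eqP ->.
apply: smallest_sub; first exact: sigma_algebra_measurable.
move=> _ [B mB ->].
rewrite (_ : mkset _ = \bigcap_(i in [set: 'I_m]) ((@tnth _ _ ^~ i) @^-1` B i)).
  apply: fin_bigcap_measurable => // i _.
  by rewrite -[X in measurable X]setTI; exact: measurable_tnth.
by apply/seteqP; split => [t h i _|t h i]; exact: h.
Qed.

End boxes.

(** * Independence *)

Section independence.
Local Open Scope ereal_scope.
Context (R : realType) (m : nat) d (T : measurableType d) (P : probability T R).
Variable Z : 'I_m -> {RV P >-> R}.
Hypothesis indepZ : independent_RVs Z.

Let mZ (i : 'I_m) (B : set R) : measurable B -> measurable (Z i @^-1` B).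
Proof. by move=> mB; rewrite -[X in measurable X]setTI; exact: measurable_funP. Qed.

Lemma expectation_indep_indic (B : 'I_m -> set R) :
  (forall i, measurable (B i)) ->
  \int[P]_w (\prod_(i < m) \1_(B i) (Z i w))%:E =
  \prod_(i < m) \int[P]_w (\1_(B i) (Z i w))%:E.
Proof.
move=> mB; have intB i : \int[P]_w (\1_(B i) (Z i w))%:E = P (Z i @^-1` B i).
  rewrite -[RHS](congr1 _ (setIT _)); apply/esym.
  by rewrite -integral_indic//; exact: mZ.
under eq_bigr do rewrite intB.
rewrite -indepZ// -[RHS](congr1 _ (setIT _)) -integral_indic//.
  apply: eq_integral => w _; congr EFin; rewrite indicE.
  have [Bw|Bw] := boolP (w \in _).
    by rewrite big1// => i _; rewrite indicE mem_set//; apply: (set_mem Bw).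
  have [i Bi] : exists i, ~ B i (Z i w).
    apply: contrapT => /forallNP H; move/negP: Bw; apply; apply/mem_set => i _.
    exact: contrapT (H i).
  by rewrite (bigD1 i)//= indicE memNset// mul0r.
by apply: fin_bigcap_measurable => // i _; exact: mZ.
Qed.

Lemma expectation_indep_prod (h : 'I_m -> R -> R) :
  (forall i, measurable_fun [set: R] (h i)) -> (forall i x, 0 <= h i x)%R ->
  (forall i, \int[P]_w (h i (Z i w))%:E < +oo) ->
  \int[P]_w (\prod_(i < m) h i (Z i w))%:E =
  \prod_(i < m) \int[P]_w (h i (Z i w))%:E.
Proof.
have mhZ (h' : 'I_m -> R -> R) i : measurable_fun [set: R] (h' i) ->
    measurable_fun [set: T] (fun w => h' i (Z i w)).
  by move=> mh; exact: measurableT_comp.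
(* Invariant: the h i with k <= i are indicators. *)
have main (k : nat) : forall h : 'I_m -> R -> R,
  (forall i, measurable_fun [set: R] (h i)) -> (forall i x, 0 <= h i x)%R ->
  (forall i, \int[P]_w (h i (Z i w))%:E < +oo) ->
  (forall i : 'I_m, (k <= i)%N -> exists2 B, measurable B & h i = \1_B) ->
  \int[P]_w (\prod_(i < m) h i (Z i w))%:E =
  \prod_(i < m) \int[P]_w (h i (Z i w))%:E.
  elim: k => [|k IH] {}h mh h0 hfin hind.
    have /choice[B HB] (i : 'I_m) : exists B : set R,
        measurable B /\ h i = \1_B.
      by have [B mB hB] := hind i isT; exists B.
    have -> : h = fun i => \1_(B i) by apply/funext => i; case: (HB i).
    by apply: expectation_indep_indic => i; case: (HB i).
  have [km|mk] := ltnP k m; last first.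
    apply: IH => // i ki; have := leq_ltn_trans ki (ltn_ord i).
    by rewrite ltnNge mk.
  pose k' : 'I_m := Ordinal km.
  (* With weight [Y] on the left and the constant weight [C] on the right, transfer reduces [h k']
     to an indicator, where the induction hypothesis applies. Finiteness of the integrals makes [C]
     a real weight. *)
  pose Y w := (\prod_(i < m | i != k') h i (Z i w))%R.
  pose C := (\prod_(i < m | i != k') fine (\int[P]_w (h i (Z i w))%:E))%R.
  have CE : C%:E = \prod_(i < m | i != k') \int[P]_w (h i (Z i w))%:E.
    rewrite /C -prodEFin; apply: eq_bigr => i _; rewrite fineK//.
    by rewrite ge0_fin_numE//; apply: integral_ge0 => w _; rewrite lee_fin.
  have C0 : (0 <= C)%R.
    by apply: prodr_ge0 => i _; apply: fine_ge0; apply: integral_ge0 => w _; rewrite lee_fin.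
  rewrite (bigD1 k')//= -CE muleC.
  rewrite -ge0_integralZl//; last 2 first.
  - by apply/measurable_EFinP; exact: mhZ.
  - by move=> w _; rewrite lee_fin.
  under [LHS]eq_integral do rewrite (bigD1 k')//= mulrC EFinM -/(Y _).
  have mY : measurable_fun [set: T] Y.
    rewrite /Y; under eq_fun do rewrite -big_filter.
    by apply: measurable_prod => i _; exact: mhZ.
  have H := @ge0_integral_transfer R _ T _ T _ R P P Y (cst C) (Z k') (Z k')
    (EFin \o h k').
  apply: H => //.
  - by move=> w; apply: prodr_ge0.
  - exact/measurable_EFinP.
  - by move=> x; rewrite lee_fin.
  move=> B mB.
  pose h' i := if i == k' then \1_B else h i.
  have h'k : h' k' = \1_B by rewrite /h' eqxx.
  have h'N i : i != k' -> h' i = h i by rewrite /h' => /negbTE ->.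
  have indfin : \int[P]_w (\1_B (Z k' w))%:E < +oo.
    apply: (@le_lt_trans _ _ 1); last exact: ltry.
    rewrite -[leRHS](@probability_setT _ _ _ P) -[leRHS]mul1e -integral_cst//.
    apply: ge0_le_integral => //.
    - apply/measurable_EFinP; apply: measurableT_comp => //.
    - by move=> w _; rewrite lee_fin indicE; case: (_ \in _).
  have := IH h'; rewrite (bigD1 k')//= h'k.
  under [X in _ * X]eq_bigr => i ik do under eq_integral do rewrite (h'N _ ik).
  rewrite -CE [RHS]/= ge0_integralZl//; last first.
    by apply/measurable_EFinP; apply: measurableT_comp.
  rewrite muleC => <-.
  - apply: eq_integral => w _; rewrite (bigD1 k')//= h'k mulrC EFinM.
    congr (_%:E * _); apply: eq_bigr => i ik; by rewrite (h'N _ ik).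
  - by move=> i; rewrite /h'; case: ifP.
  - by move=> i x; rewrite /h'; case: ifP.
  - by move=> i; rewrite /h'; case: ifPn => [/eqP ->|].
  - move=> i; rewrite leq_eqVlt => /predU1P[ki|ki].
      exists B => //; rewrite (_ : i = k') ?h'k//; exact/val_inj.
    rewrite h'N; first exact: hind.
    by apply: contraTneq ki => ->; rewrite ltnn.
move=> mh h0 hfin; apply: (main m) => // i.
by rewrite leqNgt ltn_ord.
Qed.

End independence.

(** * Standard Gaussian vectors *)

Section gaussian_vectors.
Local Open Scope ereal_scope.
Context (R : realType) (m : nat).

Definition cV_of_tuple (t : m.-tuple R) : 'cV[R]_m := (\col_i tnth t i)%R.

(* Measurability of a map on column vectors is inherited from the product
   sigma-algebra of m.-tuple R. *)
Definition measurable_cV (g : 'cV[R]_m -> R) :=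
  measurable_fun [set: m.-tuple R] (g \o cV_of_tuple).

Lemma measurable_cV_comp d (T : measurableType d) (g : 'cV[R]_m -> R)
    (X : T -> 'cV[R]_m) :
  measurable_cV g ->
  (forall i, measurable_fun [set: T] (fun w => X w i 0%R)) ->
  measurable_fun [set: T] (fun w => g (X w)).
Proof.
move=> mg mX.
rewrite (_ : (fun w => _) =
    (g \o cV_of_tuple) \o (fun w => [tuple X w i 0%R | i < m])).
  apply: measurableT_comp => //; apply/measurable_fun_tnthP => i.
  by apply: eq_measurable_fun (mX i) => w _ /=; rewrite tnth_mktuple.
apply/funext => w /=; congr g; apply/colP => i.
by rewrite mxE tnth_mktuple.
Qed.

Lemma measurable_cV_coord (i : 'I_m) : measurable_cV (fun v => v i 0%R).
Proof.
rewrite /measurable_cV (_ : _ \o _ = @tnth m R ^~ i); first exact: measurable_tnth.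
by apply/funext => t; rewrite /= mxE.
Qed.

Definition rv_col d (T : measurableType d) (P : probability T R)
  (Z : 'I_m -> {RV P >-> R}) (w : T) : 'cV[R]_m := (\col_i Z i w)%R.

Lemma measurable_rv_col d (T : measurableType d) (P : probability T R)
    (Z : 'I_m -> {RV P >-> R}) i :
  measurable_fun [set: T] (fun w => rv_col Z w i 0%R).
Proof. by under eq_fun do rewrite mxE; exact: measurable_funP. Qed.

Definition affine_weight_cV (c a z : 'cV[R]_m) : R :=
  (\prod_(i < m) affine_weight (c i 0) (a i 0) (z i 0))%R.

Lemma affine_weight_cV_ge0 c a z : (0 <= affine_weight_cV c a z)%R.
Proof. by apply: prodr_ge0 => i _; exact: affine_weight_ge0. Qed.

Definition affine_cV (c a z : 'cV[R]_m) : 'cV[R]_m :=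
  (\col_i (c i 0 * z i 0 + a i 0))%R.

Lemma measurable_affine_weight_cV c a : measurable_cV (affine_weight_cV c a).
Proof.
apply: measurable_prod => i _.
apply: measurableT_comp; first exact: measurable_affine_weight.
exact: measurable_cV_coord.
Qed.

(** For a diagonal map the weight and the indicator of a box both factor over the coordinates, so
    independence reduces the identity on boxes to [std_normal_affine_change]; boxes form a
    generating pi-system. *)
Lemma standard_normals_affine_change d (T : measurableType d)
    (P : probability T R) (Z : 'I_m -> {RV P >-> R})
    d' (T' : measurableType d') (P' : probability T' R)
    (Z' : 'I_m -> {RV P' >-> R}) (c a : 'cV[R]_m) (g : 'cV[R]_m -> R) :
  standard_normals Z -> standard_normals Z' -> (forall i, c i 0%R != 0%R) ->
  measurable_cV g -> (forall v, 0 <= g v)%R ->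
  \int[P]_w (g (rv_col Z w))%:E =
  \int[P']_w (affine_weight_cV c a (rv_col Z' w) *
              g (affine_cV c a (rv_col Z' w)))%:E.
Proof.
move=> [indZ NZ] [indZ' NZ'] c0 mg g0.
pose f1 (w : T) := [tuple Z i w | i < m].
pose f2 (w : T') := [tuple (c i 0 * Z' i w + a i 0)%R | i < m].
have mf1 : measurable_fun [set: T] f1.
  apply/measurable_fun_tnthP => i.
  rewrite (_ : _ \o _ = Z i); first exact: measurable_funP.
  by apply/funext => w /=; rewrite tnth_mktuple.
have mf2 : measurable_fun [set: T'] f2.
  apply/measurable_fun_tnthP => i.
  rewrite (_ : _ \o _ = (fun z : R => c i 0 * z + a i 0)%R \o Z' i).
    by apply: measurableT_comp => //; exact: measurable_affine.
  by apply/funext => w /=; rewrite tnth_mktuple.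
pose w2 w := affine_weight_cV c a (rv_col Z' w).
have mw2 : measurable_fun [set: T'] w2.
  apply: measurable_cV_comp; first exact: measurable_affine_weight_cV.
  exact: measurable_rv_col.
have -> : \int[P]_w (g (rv_col Z w))%:E =
    \int[P]_w ((cst 1%R w)%:E * (EFin \o (g \o cV_of_tuple)) (f1 w)).
  apply: eq_integral => w _; rewrite mul1e /=; congr (g _)%:E.
  by apply/colP => i; rewrite !mxE tnth_mktuple.
have -> : \int[P']_w (affine_weight_cV c a (rv_col Z' w) *
                      g (affine_cV c a (rv_col Z' w)))%:E =
    \int[P']_w ((w2 w)%:E * (EFin \o (g \o cV_of_tuple)) (f2 w)).
  apply: eq_integral => w _; rewrite EFinM /=; congr (_ * (g _)%:E).
  by apply/colP => i; rewrite !mxE tnth_mktuple.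
apply: ge0_integral_transfer => //.
- by move=> x; exact: affine_weight_cV_ge0.
- exact/measurable_EFinP.
- by move=> x; rewrite lee_fin /=.
move=> B mB; rewrite !integral_weighted_indic.
move: B mB; apply: (integral_weighted_pi_system (G := @boxes R m)) => //.
- by move=> x; exact: affine_weight_cV_ge0.
- exact: measurable_tuple_boxes.
- exact: boxes_setI.
- exact: boxesT.
- rewrite (@eq_integral _ _ _ P _ (cst 1))// integral_cst// mul1e.
  by apply: le_lt_trans (probability_le1 P measurableT) _; exact: ltry.
move=> _ [B mB ->]; rewrite -!integral_weighted_indic.
pose h i (z : R) := (affine_weight (c i 0) (a i 0) z * \1_(B i) (c i 0 * z + a i 0))%R.
have mh i : measurable_fun [set: R] (h i).
  apply: measurable_funM; first exact: measurable_affine_weight.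
  by apply: measurableT_comp => //; exact: measurable_affine.
have h0 i x : (0 <= h i x)%R by rewrite mulr_ge0 ?affine_weight_ge0.
have intB i : \int[P']_w (h i (Z' i w))%:E = \int[P]_w (\1_(B i) (Z i w))%:E.
  rewrite (@std_normal_affine_change _ _ _ _ (Z i) _ _ _ (Z' i) (c i 0%R)
    (a i 0%R) (fun z => (\1_(B i) z)%:E))//.
  - exact: NZ.
  - exact: NZ'.
  - exact/measurable_EFinP.
have indic_box (t : m.-tuple R) : \1_[set t | forall i, B i (tnth t i)] t =
    (\prod_(i < m) \1_(B i) (tnth t i))%R :> R.
  rewrite indicE; have [Bt|Bt] := boolP (t \in _).
    by rewrite big1// => i _; rewrite indicE mem_set//; exact: (set_mem Bt).
  have [i Bi] : exists i, ~ B i (tnth t i).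
    apply: contrapT => /forallNP H; move/negP: Bt; apply; apply/mem_set => i.
    exact: contrapT (H i).
  by rewrite (bigD1 i)//= indicE memNset// mul0r.
transitivity (\int[P]_w (\prod_(i < m) \1_(B i) (Z i w))%:E).
  apply: eq_integral => w _; rewrite mul1e; congr EFin; rewrite indic_box.
  by apply: eq_bigr => i _; rewrite tnth_mktuple.
rewrite (expectation_indep_indic indZ)//.
transitivity (\int[P']_w (\prod_(i < m) h i (Z' i w))%:E); last first.
  apply: eq_integral => w _; rewrite -EFinM; congr EFin.
  rewrite indic_box /w2 /affine_weight_cV -big_split/=.
  by apply: eq_bigr => i _; rewrite tnth_mktuple mxE.
rewrite (expectation_indep_prod indZ')//.
  by apply: eq_bigr => i _; rewrite intB.
move=> i; rewrite intB; apply: (@le_lt_trans _ _ 1); last exact: ltry.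
rewrite -[leRHS](@probability_setT _ _ _ P) -[leRHS]mul1e -integral_cst//.
apply: ge0_le_integral => //.
- by apply/measurable_EFinP; apply: measurableT_comp.
- by move=> w _; rewrite lee_fin indicE; case: (_ \in _).
Qed.

End gaussian_vectors.

(** * Exponential moments, reflection invariance and the fourth moment *)

Section moments.
Local Open Scope ereal_scope.
Context (R : realType) (m : nat).

Definition sqn (v : 'cV[R]_m) : R := (\sum_(i < m) v i 0 ^+ 2)%R.

Lemma sqn_ge0 v : (0 <= sqn v)%R.
Proof. by apply: sumr_ge0 => i _; exact: sqr_ge0. Qed.

Lemma measurable_sqn : measurable_cV sqn.
Proof.
by apply: measurable_sum => i; apply: measurable_funX; exact: measurable_cV_coord.
Qed.

Context d (T : measurableType d) (P : probability T R).
Variable Z : 'I_m -> {RV P >-> R}.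
Hypothesis normalZ : standard_normals Z.

Lemma integral_prob_cst (r : \bar R) : \int[P]_w r = r.
Proof.
rewrite (@eq_integral _ _ _ P _ (cst r))// integral_cst//.
have := @probability_setT _ _ _ P => /= ->.
by rewrite mule1.
Qed.

(** The total mass 1 is rewritten through z -> b z, whose weight is b^m times this exponential. For
    b < 1 this is an exponential moment; a general b normalizes the comparison of Gaussian laws. *)
Lemma expectation_exp_sqn (b : R) : (0 < b)%R ->
  \int[P]_w (expR ((1 - b ^+ 2) / 2 * sqn (rv_col Z w)))%:E = (b ^- m)%:E.
Proof.
move=> b0.
have mE : measurable_fun [set: T]
    (fun w => expR ((1 - b ^+ 2) / 2 * sqn (rv_col Z w))%R).
  apply: measurableT_comp => //; apply: measurable_funM => //.
  by apply: measurable_cV_comp; [exact: measurable_sqn|exact: measurable_rv_col].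
have := @standard_normals_affine_change _ _ _ _ P Z _ _ P Z (const_mx b)
  0%R (cst 1%R) normalZ normalZ.
rewrite (integral_prob_cst 1) => H.
have {}H : 1 = (b ^+ m)%:E *
    \int[P]_w (expR ((1 - b ^+ 2) / 2 * sqn (rv_col Z w)))%:E.
  rewrite -ge0_integralZl//; last 2 first.
  - exact/measurable_EFinP.
  - by rewrite lee_fin exprn_ge0// ltW.
  rewrite H//.
  - apply: eq_integral => w _; rewrite -EFinM mulr1; congr EFin.
    rewrite /affine_weight_cV /affine_weight.
    under eq_bigr => i _ do rewrite !mxE addr0 (gtr0_norm b0).
    rewrite big_split/= prodr_const card_ord; congr (_ * _)%R.
    rewrite -expR_sum; congr expR; rewrite mulr_sumr; apply: eq_bigr => i _.
    by rewrite !mxE; field.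
  - by move=> i; rewrite mxE gt_eqF.
  - exact: measurable_cst.
have bm : (b ^+ m != 0)%R by rewrite gt_eqF// exprn_gt0.
by rewrite -[RHS]mule1 [in RHS]H muleA -EFinM mulVf// mul1e.
Qed.

(** Sign changes have affine weight 1. Positive and negative parts are transferred separately, so
    the identity holds in the extended reals and can be used before integrability is known. *)
Lemma expectation_reflection (e : 'cV[R]_m) (g : 'cV[R]_m -> R) :
  (forall i, `|e i 0%R| = 1)%R -> measurable_cV g ->
  \int[P]_w (g (rv_col Z w))%:E =
  \int[P]_w (g (\col_i (e i 0 * Z i w)))%:E.
Proof.
move=> e1 mg.
have ge0 (h : 'cV[R]_m -> R) : measurable_cV h -> (forall v, 0 <= h v)%R ->
    \int[P]_w (h (rv_col Z w))%:E = \int[P]_w (h (\col_i (e i 0 * Z i w)))%:E.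
  move=> mh h0.
  rewrite (@standard_normals_affine_change _ _ _ _ P Z _ _ P Z e 0%R h)//.
    apply: eq_integral => w _.
    rewrite /affine_weight_cV big1; last first.
      move=> i _; rewrite /affine_weight e1 !mxE addr0 exprMn.
      have -> : (e i 0 ^+ 2 = 1)%R.
        by rewrite -real_normK ?num_real// e1 expr1n.
      by rewrite !mul1r subrr mul0r expR0.
    rewrite mul1r; congr (h _)%:E; apply/colP => i.
    by rewrite !mxE addr0.
  by move=> i; rewrite -normr_eq0 e1 oner_eq0.
have posE (f : T -> R) : \int[P]_w (fun w => (f w)%:E)^\+ w =
    \int[P]_w (Num.max (f w) 0)%:E.
  by apply: eq_integral => w _; rewrite funeposE EFin_max.
have negE (f : T -> R) : \int[P]_w (fun w => (f w)%:E)^\- w =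
    \int[P]_w (Num.max (- f w) 0)%:E.
  by apply: eq_integral => w _; rewrite funenegE EFin_max.
rewrite integralE [RHS]integralE !posE !negE; congr (_ - _).
- apply: (ge0 (fun v => Num.max (g v) 0%R)).
    exact: measurable_maxr.
  by move=> v; rewrite le_max lexx orbT.
- apply: (ge0 (fun v => Num.max (- g v) 0)%R).
    by apply: measurable_maxr => //; exact: measurable_funN.
  by move=> v; rewrite le_max lexx orbT.
Qed.

(* From |z|^4 <= 32 e^{|z|^2/4} and expectation_exp_sqn at b = 1 / sqrt 2. *)
Definition normal_fourth_moment_bound : R :=
  (32 * ((Num.sqrt 2)^-1 ^- m))%R.

Lemma sqr_le_expR (x : R) : (0 <= x)%R -> (x ^+ 2 <= 32 * expR (x / 4))%R.
Proof.
move=> x0; have := @expR_ge1Dxn R (x / 4) 1.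
rewrite divr_ge0// => /(_ isT); rewrite exprMn exprVn.
have -> : (1.+1`!%:R = 2 :> R)%R by [].
by move=> H; lra.
Qed.

Lemma expectation_sqn2_le :
  \int[P]_w (sqn (rv_col Z w) ^+ 2)%:E <= normal_fourth_moment_bound%:E.
Proof.
have mS : measurable_fun [set: T] (fun w => sqn (rv_col Z w)).
  by apply: measurable_cV_comp; [exact: measurable_sqn|exact: measurable_rv_col].
have mE : measurable_fun [set: T] (fun w => expR (sqn (rv_col Z w) / 4)).
  by apply: measurableT_comp => //; apply: measurable_funM.
have b0 : (0 < (Num.sqrt 2)^-1 :> R)%R by rewrite invr_gt0 sqrtr_gt0.
rewrite /normal_fourth_moment_bound EFinM -expectation_exp_sqn//.
have b2 : ((Num.sqrt 2)^-1 ^+ 2 = 1 / 2 :> R)%R.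
  by rewrite exprVn sqr_sqrtr ?div1r.
have -> : \int[P]_w (expR ((1 - (Num.sqrt 2)^-1 ^+ 2) / 2 * sqn (rv_col Z w)))%:E =
    \int[P]_w (expR (sqn (rv_col Z w) / 4))%:E.
  apply: eq_integral => w _; congr (expR _)%:E; rewrite b2; lra.
rewrite -ge0_integralZl//; last first.
  exact/measurable_EFinP.
apply: ge0_le_integral => //.
- by move=> w _; rewrite lee_fin sqr_ge0.
- by apply/measurable_EFinP; exact: measurable_funX.
- by apply/measurable_EFinP; apply: measurable_funM.
- by move=> w _; rewrite -EFinM lee_fin sqr_le_expR ?sqn_ge0.
Qed.

End moments.

(** * Variances and covariances of standard normal variables *)

Section covariance.
Local Open Scope ereal_scope.
Context (R : realType).

Section one_dimensional.
Context d (T : measurableType d) (P : probability T R) (Z : {RV P >-> R}).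
Hypothesis NZ : std_normal Z.

Lemma expectation_exp_sqr (c : R) : (0 < c)%R ->
  \int[P]_w (expR ((1 - c ^+ 2) / 2 * Z w ^+ 2))%:E = c^-1%:E.
Proof.
move=> c0.
have mE : measurable_fun [set: T]
    (fun w => expR ((1 - c ^+ 2) / 2 * Z w ^+ 2)%R).
  by apply: measurableT_comp => //; apply: measurable_funM => //; apply: measurable_funX.
have H : 1 = c%:E * \int[P]_w (expR ((1 - c ^+ 2) / 2 * Z w ^+ 2))%:E.
  rewrite -ge0_integralZl//; last 2 first.
  - exact/measurable_EFinP.
  - by rewrite lee_fin ltW.
  rewrite -(integral_prob_cst P 1).
  rewrite (@std_normal_affine_change _ _ _ _ Z _ _ _ Z c 0%R (cst 1))//.
    apply: eq_integral => w _; rewrite mule1 -EFinM; congr EFin.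
    by rewrite /affine_weight gtr0_norm// addr0; congr (_ * expR _)%R; field.
  by rewrite gt_eqF.
by rewrite -[RHS]mule1 [in RHS]H muleA -EFinM mulVf ?gt_eqF// mul1e.
Qed.

Lemma expectation_sqr_fin : \int[P]_w (Z w ^+ 2)%:E < +oo.
Proof.
have b0 : (0 < (Num.sqrt 2)^-1 :> R)%R by rewrite invr_gt0 sqrtr_gt0.
have b2 : ((Num.sqrt 2)^-1 ^+ 2 = 1 / 2 :> R)%R.
  by rewrite exprVn sqr_sqrtr ?div1r.
have mE : measurable_fun [set: T] (fun w => expR (1 / 4 * Z w ^+ 2)).
  by apply: measurableT_comp => //; apply: measurable_funM => //; apply: measurable_funX.
apply: (@le_lt_trans _ _ (\int[P]_w (4%:E * (expR (1 / 4 * Z w ^+ 2))%:E))).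
  apply: ge0_le_integral => //.
  - by move=> w _; rewrite lee_fin sqr_ge0.
  - by apply/measurable_EFinP; exact: measurable_funX.
  - by apply/measurable_EFinP; apply: measurable_funM.
  - move=> w _; rewrite -EFinM lee_fin.
    by have := expR_ge1Dx (1 / 4 * Z w ^+ 2); lra.
rewrite ge0_integralZl//; last exact/measurable_EFinP.
have := expectation_exp_sqr b0; rewrite b2.
have -> : ((1 - 1 / 2) / 2 = 1 / 4 :> R)%R by lra.
by move=> ->; rewrite -EFinM ltry.
Qed.

(* Integrating 1 + x <= e^x gives 1/c >= 1 + (1 - c^2)/2 E[Z^2] for all c > 0;
   letting c tend to 1 from either side pins down the variance. *)
Lemma expectation_sqr_std_normal : \int[P]_w (Z w ^+ 2)%:E = 1.
Proof.
have Vfin : \int[P]_w (Z w ^+ 2)%:E \is a fin_num.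
  rewrite ge0_fin_numE; first exact: expectation_sqr_fin.
  by apply: integral_ge0 => w _; rewrite lee_fin sqr_ge0.
set V := fine (\int[P]_w (Z w ^+ 2)%:E).
have VE : \int[P]_w (Z w ^+ 2)%:E = V%:E by rewrite fineK.
have V0 : (0 <= V)%R.
  by apply: fine_ge0; apply: integral_ge0 => w _; rewrite lee_fin sqr_ge0.
have mZ2 : measurable_fun [set: T] (fun w => Z w ^+ 2)%R by exact: measurable_funX.
have key (c : R) : (0 < c)%R -> (1 + (1 - c ^+ 2) / 2 * V <= c^-1)%R.
  move=> c0; set k := ((1 - c ^+ 2) / 2)%R.
  have mE : measurable_fun [set: T] (fun w => expR (k * Z w ^+ 2)).
    by apply: measurableT_comp => //; apply: measurable_funM.
  (* Only nonnegative functions are integrated: for k < 0 the term k Z^2 is moved to the other side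
     of 1 + x <= e^x. *)
  have [k0|k0] := leP 0%R k.
    rewrite -lee_fin -expectation_exp_sqr// -/k EFinD EFinM -VE.
    rewrite -ge0_integralZl//; last 2 first.
    - exact/measurable_EFinP.
    - by move=> w _; rewrite lee_fin sqr_ge0.
    rewrite -(integral_prob_cst P 1) -ge0_integralD//; last 2 first.
    - by move=> w _; rewrite -EFinM lee_fin mulr_ge0 ?sqr_ge0.
    - by apply/measurable_EFinP; apply: measurable_funM.
    apply: ge0_le_integral => //.
    - by move=> w _; rewrite -EFinM -EFinD lee_fin addr_ge0// mulr_ge0 ?sqr_ge0.
    - by apply/measurable_EFinP; apply: measurable_funD => //; apply: measurable_funM.
    - exact/measurable_EFinP.
    - by move=> w _; rewrite -EFinM -EFinD lee_fin expR_ge1Dx.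
  suff : (1 <= c^-1 + (- k) * V)%R by lra.
  have k0' : (0 <= - k)%R by rewrite oppr_ge0 ltW.
  rewrite -lee_fin EFinD EFinM -VE -expectation_exp_sqr// -/k.
  rewrite -ge0_integralZl//; last 2 first.
  - exact/measurable_EFinP.
  - by move=> w _; rewrite lee_fin sqr_ge0.
  rewrite -(integral_prob_cst P 1) -ge0_integralD//; last 3 first.
  - exact/measurable_EFinP.
  - by move=> w _; rewrite -EFinM lee_fin mulr_ge0 ?sqr_ge0.
  - by apply/measurable_EFinP; apply: measurable_funM.
  apply: ge0_le_integral => //.
  - by apply/measurable_EFinP; apply: measurable_funD => //; apply: measurable_funM.
  - move=> w _; rewrite -EFinM -EFinD lee_fin.
    by have := expR_ge1Dx (k * Z w ^+ 2); lra.
rewrite VE; congr EFin; apply/eqP; rewrite eq_le; apply/andP; split.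
  rewrite leNgt; apply/negP => V1.
  (* At c = 1 - e the inequality reads e ((2 - e)(1 - e) V - 2) <= 0. This e makes the first-order
     loss 3 e V equal to V - 1, half of the gap 2 (V - 1), so the bracket stays positive. *)
  pose e := ((V - 1) / (3 * V))%R.
  have eV : (e * (3 * V) = V - 1)%R by rewrite /e divfK// gt_eqF//; lra.
  have e0 : (0 < e)%R by rewrite divr_gt0//; lra.
  have e1 : (e < 1 / 3)%R by nra.
  have := key (1 - e)%R; rewrite subr_gt0 => /(_ ltac:(lra)).
  rewrite -(ler_pM2r (_ : 0 < 1 - e)%R); last by lra.
  rewrite mulVf => [H|]; last by rewrite gt_eqF//; lra.
  have : (e * ((2 - e) * (1 - e) * V - 2) <= 0)%R by lra.
  apply/negP; rewrite -ltNge mulr_gt0//.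
  have -> : ((2 - e) * (1 - e) * V - 2 = 2 * V - e * (3 * V) + e * (e * V) - 2)%R.
    by ring.
  have e0' : (0 <= e)%R by exact: ltW.
  rewrite eV; have : (0 <= e * (e * V))%R by exact: mulr_ge0 e0' (mulr_ge0 e0' V0).
  lra.
rewrite leNgt; apply/negP => V1.
(* At c = 1 + e the bracket (2 + e)(1 + e) V - 2 is at most 2 V + 4 e V - 2, as e <= 1; here 4 e V =
   (1 - V) V is less than the gap 2 (1 - V). *)
pose e := ((1 - V) / 4)%R.
have eV : (e * 4 = 1 - V)%R by rewrite /e; lra.
have := key (1 + e)%R => /(_ ltac:(lra)).
rewrite -(ler_pM2r (_ : 0 < 1 + e)%R); last by lra.
rewrite mulVf => [H|]; last by rewrite gt_eqF//; lra.
have : (0 <= e * ((2 + e) * (1 + e) * V - 2))%R by lra.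
apply/negP; rewrite -ltNge pmulr_rlt0; last by lra.
have e4 : (e <= 1)%R by lra.
have e0 : (0 <= e)%R by lra.
clearbody e; have h1 : (0 <= e * V * (1 - e))%R by rewrite !mulr_ge0//; lra.
have h2 : (0 < (1 - V) * (1 - V))%R by rewrite mulr_gt0//; lra.
have h3 : (e * 4 * V = (1 - V) * V)%R by rewrite eV.
lra.
Qed.

End one_dimensional.

Context (m : nat) d (T : measurableType d) (P : probability T R).
Variable Z : 'I_m -> {RV P >-> R}.
Hypothesis normalZ : standard_normals Z.

Lemma integrable_std_normal_mul (i j : 'I_m) :
  P.-integrable [set: T] (fun w => (Z i w * Z j w)%:E).
Proof.
apply/integrableP; split.
  by apply/measurable_EFinP; exact: measurable_funM.
have NZ k := normalZ.2 k.
apply: (@le_lt_trans _ _ (\int[P]_w ((Z i w ^+ 2)%:E + (Z j w ^+ 2)%:E))).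
  apply: ge0_le_integral => //.
  - by apply: measurableT_comp => //; apply/measurable_EFinP; exact: measurable_funM.
  - by apply/measurable_EFinP; apply: measurable_funD; exact: measurable_funX.
  - move=> w _; rewrite -EFinD lee_fin ler_norml.
    by apply/andP; split; nra.
rewrite ge0_integralD//; last 4 first.
- by move=> w _; rewrite lee_fin sqr_ge0.
- by apply/measurable_EFinP; exact: measurable_funX.
- by move=> w _; rewrite lee_fin sqr_ge0.
- by apply/measurable_EFinP; exact: measurable_funX.
by apply: lte_add_pinfty; apply: expectation_sqr_fin; exact: NZ.
Qed.

(** Off the diagonal, flipping the sign of coordinate i alone turns the integral into its opposite;
    being finite, it vanishes. This avoids a product formula for signed functions of independent
    variables. *)
Lemma expectation_std_normal_mul (i j : 'I_m) :
  \int[P]_w (Z i w * Z j w)%:E = ((i == j)%:R)%:E.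
Proof.
have [<-|ij] := eqVneq i j.
  under eq_integral do rewrite -expr2.
  by rewrite expectation_sqr_std_normal//; exact: (normalZ.2 i).
pose e : 'cV[R]_m := (\col_k (if k == i then -1 else 1))%R.
have := @expectation_reflection R m _ T P Z normalZ e
  (fun v => v i 0 * v j 0)%R.
set I := integral _ _ _ => H.
have {}H : I = - I.
  rewrite [LHS]H.
  - rewrite -integralN/=.
      apply: eq_integral => w _; rewrite !mxE eqxx eq_sym (negbTE ij).
      by rewrite mulN1r mul1r mulNr.
    apply: integrable_add_def => //.
    apply: eq_integrable (integrable_std_normal_mul i j) => // w _.
    by rewrite !mxE.
  - by move=> k; rewrite mxE; case: ifP => _; rewrite ?normrN normr1.
  - by apply: measurable_funM; exact: measurable_cV_coord.
have Ifin : I \is a fin_num.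
  have := integrable_fin_num measurableT (integrable_std_normal_mul i j).
  by congr (_ \is a fin_num); apply: eq_integral => w _; rewrite !mxE.
transitivity I; first by apply: eq_integral => w _; rewrite !mxE.
move: H; rewrite -(fineK Ifin) => -[]; move: (fine I) => r Hr.
by congr EFin; change (r = 0)%R; lra.
Qed.

End covariance.

(** * Comparison of Gaussian laws *)

Section comparison.
Local Open Scope ereal_scope.
Context (R : realType) (m : nat).

Lemma measurable_mulmx d (T : measurableType d) n (B : 'M[R]_(n, m))
    (X : T -> 'cV[R]_m) i :
  (forall j, measurable_fun [set: T] (fun w => X w j 0%R)) ->
  measurable_fun [set: T] (fun w => (B *m X w)%R i 0%R).
Proof.
move=> mX; under eq_fun do rewrite mxE.
by apply: measurable_sum => j; exact: measurable_funM.
Qed.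

Lemma measurable_cV_mulmx (B : 'M[R]_m) (g : 'cV[R]_m -> R) :
  measurable_cV g -> measurable_cV (fun v => g (B *m v)%R).
Proof.
move=> mg; apply: (measurable_cV_comp mg) => i; apply: measurable_mulmx => j.
exact: measurable_cV_coord.
Qed.

Lemma measurable_cV_translate (a : 'cV[R]_m) (g : 'cV[R]_m -> R) :
  measurable_cV g -> measurable_cV (fun v => g (v + a)%R).
Proof.
move=> mg; apply: (measurable_cV_comp mg) => i.
under eq_fun do rewrite mxE.
by apply: measurable_funD => //; exact: measurable_cV_coord.
Qed.

Lemma measurable_cV_exp_sqn (k : R) :
  measurable_cV (fun v : 'cV[R]_m => expR (k * sqn v)).
Proof.
by apply: measurableT_comp => //; apply: measurable_funM => //; exact: measurable_sqn.
Qed.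

Section translation.
Context d (T : measurableType d) (P : probability T R) (Z : 'I_m -> {RV P >-> R}).
Hypothesis normalZ : standard_normals Z.

(* The density e^{|z|^2/2} turns the standard Gaussian law into a multiple of
   the Lebesgue measure. *)
Lemma lebesgue_weight_translate (a : 'cV[R]_m) (g : 'cV[R]_m -> R) :
  measurable_cV g -> (forall v, 0 <= g v)%R ->
  \int[P]_w (g (rv_col Z w + a) * expR (1 / 2 * sqn (rv_col Z w)))%:E =
  \int[P]_w (g (rv_col Z w) * expR (1 / 2 * sqn (rv_col Z w)))%:E.
Proof.
move=> mg g0; pose h v := (g v * expR (1 / 2 * sqn v))%R.
rewrite [RHS](@standard_normals_affine_change _ _ _ _ P Z _ _ P Z (const_mx 1%R)
  a h)//.
- apply: eq_integral => w _; rewrite /h mulrCA.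
  have -> : affine_cV (const_mx 1%R) a (rv_col Z w) = (rv_col Z w + a)%R.
    by apply/colP => i; rewrite !mxE mul1r.
  congr (_ * _)%:E; rewrite /affine_weight_cV /affine_weight.
  under eq_bigr do rewrite !mxE normr1 !mul1r.
  rewrite -expR_sum -expRD; congr expR; rewrite /sqn !mulr_sumr -big_split/=.
  by apply: eq_bigr => i _; rewrite !mxE; field.
- by move=> i; rewrite mxE oner_eq0.
- by apply: measurable_funM => //; exact: measurable_cV_exp_sqn.
- by move=> v; rewrite mulr_ge0// expR_ge0.
Qed.

(** Since B z + a = B (z + B^-1 a), a translation after [B] is a translation before it. *)
Lemma lebesgue_weight_translate_mulmx (B : 'M[R]_m) (a : 'cV[R]_m)
    (g : 'cV[R]_m -> R) :
  B \in unitmx -> measurable_cV g -> (forall v, 0 <= g v)%R ->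
  \int[P]_w (g (B *m rv_col Z w + a) * expR (1 / 2 * sqn (rv_col Z w)))%:E =
  \int[P]_w (g (B *m rv_col Z w) * expR (1 / 2 * sqn (rv_col Z w)))%:E.
Proof.
move=> uB mg g0.
rewrite -(@lebesgue_weight_translate (invmx B *m a) (fun v => g (B *m v)%R))//.
  by apply: eq_integral => w _; rewrite mulmxDr mulKVmx.
exact: measurable_cV_mulmx.
Qed.

End translation.

Context d (T : measurableType d) (P : probability T R) (Z : 'I_m -> {RV P >-> R}).
Context d0 (T0 : measurableType d0) (P0 : probability T0 R)
  (Z0 : 'I_m -> {RV P0 >-> R}).
Hypotheses (normalZ : standard_normals Z) (normalZ0 : standard_normals Z0).

(* Uniqueness of Haar measure: the weighted laws of Z and of B Z0 are both
   translation invariant, so they are proportional; the factor is found by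
   testing on e^{-|z|^2/2}. *)
Lemma lebesgue_weight_proportional (B : 'M[R]_m) (g : 'cV[R]_m -> R) :
  B \in unitmx -> measurable_cV g -> (forall v, 0 <= g v)%R ->
  \int[P0]_w (g (B *m rv_col Z0 w) * expR (- (1 / 2) * sqn (B *m rv_col Z0 w))
              * expR (1 / 2 * sqn (rv_col Z0 w)))%:E =
  \int[P]_w (g (rv_col Z w))%:E *
  \int[P0]_w (expR (- (1 / 2) * sqn (B *m rv_col Z0 w)) *
              expR (1 / 2 * sqn (rv_col Z0 w)))%:E.
Proof.
move=> uB mg g0.
pose f (v : 'cV[R]_m) := expR (- (1 / 2) * sqn v).
pose e (v : 'cV[R]_m) := expR (1 / 2 * sqn v).
pose G v := (g v * f v)%R.
have fe v : (f v * e v = 1)%R.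
  by rewrite -expRD mulNr addNr expR0.
have fN v : f (- v)%R = f v.
  by congr (expR (_ * _)); apply: eq_bigr => i _; rewrite mxE sqrrN.
have mf : measurable_cV f by exact: measurable_cV_exp_sqn.
have me : measurable_cV e by exact: measurable_cV_exp_sqn.
have mG : measurable_cV G by exact: measurable_funM.
have f0 v : (0 <= f v)%R by exact: expR_ge0.
have e0 v : (0 <= e v)%R by exact: expR_ge0.
have G0 v : (0 <= G v)%R by rewrite mulr_ge0.
have Hmul a b c c' k : (c * c' = 1 -> a * (b * c) * c' * k = b * (a * k) :> R)%R.
  by move=> H; ring: H.
have Hmul1 a b c k : (a * b * (c * k) = k * (a * c) * b :> R)%R by ring.
have Hmul2 a b c k : (k * (a * b) * c = a * b * c * k :> R)%R by ring.
pose x (p : T * T0) := rv_col Z p.1.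
pose y (p : T * T0) := (B *m rv_col Z0 p.2)%R.
have mx i : measurable_fun [set: T * T0] (fun p => x p i 0%R).
  by apply: (measurableT_comp (measurable_rv_col Z i)).
have mz i : measurable_fun [set: T * T0] (fun p => rv_col Z0 p.2 i 0%R).
  by apply: (measurableT_comp (measurable_rv_col Z0 i)).
have my i : measurable_fun [set: T * T0] (fun p => y p i 0%R).
  exact: measurable_mulmx.
have swap (h : T * T0 -> R) : measurable_fun [set: T * T0] h ->
    (forall p, 0 <= h p)%R ->
    \int[P]_w \int[P0]_w0 (h (w, w0))%:E = \int[P0]_w0 \int[P]_w (h (w, w0))%:E.
  move=> mh h0; apply: (@fubini_tonelli _ _ _ _ R P P0 (EFin \o h)).
    exact/measurable_EFinP.
  by move=> p; rewrite lee_fin.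
(* The Fubini chain. [h1] inserts f(x) e(x) = 1; for fixed x, translating y by x recovers the
   left-hand side. For fixed y, translating x by y turns [h1] into [h2]. There, for fixed x, G(x)
   e(x) = g(x) splits off, and f(x - y) = f(y - x) is translated back to f(y). *)
pose h1 p := (f (x p) * e (x p) * (G (y p + x p) * e (rv_col Z0 p.2)))%R.
pose h2 p := (f (x p - y p) * G (x p) * e (x p) * e (rv_col Z0 p.2))%R.
have mh1 : measurable_fun [set: T * T0] h1.
  rewrite /h1; apply: measurable_funM; apply: measurable_funM;
    apply: measurable_cV_comp => // i.
  by under eq_fun do rewrite mxE; exact: measurable_funD.
have mh2 : measurable_fun [set: T * T0] h2.
  rewrite /h2; apply: measurable_funM; first apply: measurable_funM;
    first apply: measurable_funM; apply: measurable_cV_comp => // i.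
  under eq_fun do rewrite mxE [X in (_ + X)%R]mxE.
  exact: measurable_funB.
have h10 p : (0 <= h1 p)%R by exact: mulr_ge0 (mulr_ge0 _ _) (mulr_ge0 _ _).
have h20 p : (0 <= h2 p)%R.
  exact: mulr_ge0 (mulr_ge0 (mulr_ge0 _ _) _) _.
have shift v k : (0 <= k)%R ->
    \int[P]_w (f (rv_col Z w) * e (rv_col Z w) * (G (v + rv_col Z w) * k))%:E =
    \int[P]_w (f (rv_col Z w - v) * G (rv_col Z w) * e (rv_col Z w) * k)%:E.
  move=> k0; have H := @lebesgue_weight_translate _ _ P Z normalZ v
    (fun z => k * (f (z - v) * G z))%R.
  transitivity (\int[P]_w (k * (f (rv_col Z w - v) * G (rv_col Z w)) *
                           expR (1 / 2 * sqn (rv_col Z w)))%:E).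
    rewrite -H.
    - apply: eq_integral => w _; congr EFin; rewrite addrK [(v + _)%R]addrC.
      exact: Hmul1.
    - apply: (measurable_funM (measurable_cst k)); apply: measurable_funM mG.
      exact: (@measurable_cV_translate (- v)%R).
    - by move=> z; exact: mulr_ge0 k0 (mulr_ge0 (f0 _) (G0 _)).
  by apply: eq_integral => w _; congr EFin; exact: Hmul2.
transitivity (\int[P]_w \int[P0]_w0 (h1 (w, w0))%:E).
  rewrite -[LHS](integral_prob_cst P).
  apply: eq_integral => w _; rewrite -(@lebesgue_weight_translate_mulmx _ _ P0 Z0
    normalZ0 B (rv_col Z w) G)//.
  by apply: eq_integral => w0 _; rewrite /h1 fe [(1 * (G _ * _))%R]mul1r.
rewrite swap//.
transitivity (\int[P]_w \int[P0]_w0 (h2 (w, w0))%:E).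
  rewrite (swap _ mh2 h20); apply: eq_integral => w0 _.
  exact: (shift (B *m rv_col Z0 w0)%R (e (rv_col Z0 w0)) (e0 _)).
have h2E w : \int[P0]_w0 (h2 (w, w0))%:E = (g (rv_col Z w))%:E *
    \int[P0]_w0 (f (B *m rv_col Z0 w0) * e (rv_col Z0 w0))%:E.
  rewrite -(@lebesgue_weight_translate_mulmx _ _ P0 Z0 normalZ0 B
    (- rv_col Z w)%R f)// -ge0_integralZl//.
  - apply: eq_integral => w0 _; rewrite -EFinM; congr EFin.
    have fB : f (rv_col Z w - B *m rv_col Z0 w0)%R =
        f (B *m rv_col Z0 w0 - rv_col Z w)%R by rewrite -fN opprB.
    by rewrite /h2 /x /y /= fB; exact: Hmul (fe (rv_col Z w)).
  - apply/measurable_EFinP; apply: measurable_funM; last first.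
      by apply: (measurable_cV_comp me); exact: measurable_rv_col.
    apply: (measurable_cV_comp mf) => i; under eq_fun do rewrite mxE.
    by apply: measurable_funD => //; apply: measurable_mulmx => j; exact: measurable_rv_col.
  - by move=> w0 _; rewrite lee_fin; exact: mulr_ge0 (f0 _) (e0 _).
  by rewrite lee_fin.
under eq_integral do rewrite h2E.
rewrite ge0_integralZr//.
- by apply/measurable_EFinP; apply: measurable_cV_comp => //; exact: measurable_rv_col.
- by move=> w _; rewrite lee_fin.
- by apply: integral_ge0 => w _; rewrite lee_fin; exact: mulr_ge0 (f0 _) (e0 _).
Qed.

(** [b ^+ m] stands in for |det B|: the proportionality factor is the integral of exp((|z|^2 - |B
    z|^2) / 2), at least that of exp((1 - b^2) |z|^2 / 2), which is b^-m. *)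
Lemma gaussian_comparison (B : 'M[R]_m) (b : R) (g : 'cV[R]_m -> R) :
  B \in unitmx -> (0 < b)%R -> (forall v, sqn (B *m v) <= b ^+ 2 * sqn v)%R ->
  measurable_cV g -> (forall v, 0 <= g v)%R ->
  \int[P]_w (g (rv_col Z w))%:E <= (b ^+ m)%:E *
  \int[P0]_w (g (B *m rv_col Z0 w) *
              expR ((sqn (rv_col Z0 w) - sqn (B *m rv_col Z0 w)) / 2))%:E.
Proof.
move=> uB b0 Bb mg g0.
have mZ0 i : measurable_fun [set: T0] (fun w => rv_col Z0 w i 0%R).
  exact: measurable_rv_col.
have mBZ0 i : measurable_fun [set: T0] (fun w => (B *m rv_col Z0 w)%R i 0%R).
  exact: measurable_mulmx.
have Ig0 : 0 <= \int[P]_w (g (rv_col Z w))%:E.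
  by apply: integral_ge0 => w _; rewrite lee_fin.
have -> : \int[P0]_w (g (B *m rv_col Z0 w) *
    expR ((sqn (rv_col Z0 w) - sqn (B *m rv_col Z0 w)) / 2))%:E =
    \int[P0]_w (g (B *m rv_col Z0 w) * expR (- (1 / 2) * sqn (B *m rv_col Z0 w))
              * expR (1 / 2 * sqn (rv_col Z0 w)))%:E.
  apply: eq_integral => w _; rewrite -mulrA -expRD; congr (_ * expR _)%:E.
  by field.
rewrite lebesgue_weight_proportional// muleCA -[leLHS]mule1.
apply: lee_wpmul2l => //.
have bm : (b ^+ m != 0)%R by rewrite gt_eqF// exprn_gt0.
have -> : 1 = (b ^+ m)%:E * (b ^- m)%:E by rewrite -EFinM divff.
apply: lee_wpmul2l.
  by rewrite lee_fin exprn_ge0// ltW.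
rewrite -(expectation_exp_sqn normalZ0 b0); apply: ge0_le_integral => //.
- apply/measurable_EFinP.
  by apply: (measurable_cV_comp (measurable_cV_exp_sqn _)).
- apply/measurable_EFinP; apply: measurable_funM.
    by apply: (measurable_cV_comp (measurable_cV_exp_sqn _)).
  by apply: (measurable_cV_comp (measurable_cV_exp_sqn _)).
- move=> w _; rewrite lee_fin -expRD ler_expR.
  have := Bb (rv_col Z0 w); move: (sqn _) (sqn _) => p q pq. lra.
Qed.

End comparison.

(** * Taylor expansion of analytic functions *)

Section power_series.
Context (R : realType) (m : nat).
Implicit Types (k : {ffun 'I_m -> nat}) (h : 'cV[R]_m) (c : {ffun 'I_m -> nat} -> R).

Definition mdegree k : nat := (\sum_(i < m) k i)%N.

(** The index type of [box_sum] changes with n; as sequences over one fixed type, boxes of different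
    sizes can be compared and cut by degree. *)
Definition box_seq (n : nat) : seq {ffun 'I_m -> nat} :=
  [seq [ffun i => nat_of_ord ((a : {ffun 'I_m -> 'I_n}) i)]
     | a <- enum {ffun 'I_m -> 'I_n}].

Lemma box_seq_uniq n : uniq (box_seq n).
Proof.
rewrite map_inj_uniq ?enum_uniq// => a b /ffunP ab.
by apply/ffunP => i; apply: val_inj; have := ab i; rewrite !ffunE.
Qed.

Lemma mem_box_seq n k : (k \in box_seq n) = [forall i, k i < n]%N.
Proof.
apply/mapP/forallP => [[a _ ->] i|kn]; first by rewrite ffunE.
exists [ffun i => Ordinal (kn i)]; first by rewrite mem_enum.
by apply/ffunP => i; rewrite !ffunE.
Qed.

Lemma box_sumE (F : {ffun 'I_m -> nat} -> R) n :
  box_sum F n = \sum_(k <- box_seq n) F k.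
Proof. by rewrite /box_sum big_map big_enum. Qed.

Lemma mdegree_box k n : (mdegree k < n)%N -> k \in box_seq n.
Proof.
move=> kn; rewrite mem_box_seq; apply/forallP => i; apply: leq_ltn_trans kn.
by rewrite /mdegree (bigD1 i)//= leq_addr.
Qed.

Definition taylor_poly c (N : nat) h : R :=
  \sum_(k <- box_seq N | (mdegree k < N)%N) c k * monomial h k.

Lemma taylor_poly_box c N n h : (N <= n)%N ->
  \sum_(k <- box_seq n | (mdegree k < N)%N) c k * monomial h k =
  taylor_poly c N h.
Proof.
move=> Nn; rewrite /taylor_poly -big_filter -[RHS]big_filter.
apply: perm_big; apply: uniq_perm; rewrite ?filter_uniq ?box_seq_uniq// => k.
rewrite !mem_filter; case: ltnP => //= kN.
by rewrite !mdegree_box// (leq_trans kN).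
Qed.

Lemma normr_coord_le h i : `|h i 0| <= `|h|.
Proof. by rewrite /Num.norm/= mx_normrE; apply: le_trans (le_bigmax _ _ (i, 0)). Qed.

Lemma normr_monomial h k : `|monomial h k| <= `|h| ^+ mdegree k.
Proof.
rewrite /monomial normr_prod /mdegree expr_sum.
apply: ler_prod => i _; rewrite normr_ge0/= normrX.
by rewrite lerXn2r ?nnegrE// normr_coord_le.
Qed.

Lemma monomial_const (r : R) k : monomial (const_mx r) k = r ^+ mdegree k.
Proof. by rewrite /monomial /mdegree expr_sum; apply: eq_bigr => i _; rewrite mxE. Qed.

Lemma monomialN h k : monomial (- h) k = (-1) ^+ mdegree k * monomial h k.
Proof.
rewrite /monomial /mdegree expr_sum -big_split/=; apply: eq_bigr => i _.
by rewrite mxE -exprMn mulN1r.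
Qed.

Lemma monomial_degree0 h k : mdegree k = 0%N -> monomial h k = 1.
Proof.
move=> k0; rewrite /monomial big1// => i _.
suff -> : k i = 0%N by rewrite expr0.
by apply/eqP; move/eqP: k0; rewrite /mdegree sum_nat_eq0 => /forallP/(_ i).
Qed.

Lemma monomial_degree1 h k : mdegree k = 1%N ->
  monomial h k = \sum_(i < m) (k i)%:R * h i 0.
Proof.
move=> k1; have [i ki] : exists i, k i != 0%N.
  apply/existsP; rewrite -negb_forall; apply/negP => /forallP H.
  by move/eqP: k1; rewrite /mdegree big1// => i _; apply/eqP.
move: k1; rewrite /mdegree (bigD1 i)//= => ki1.
have [kiE k0] : k i = 1%N /\ (\sum_(j < m | j != i) k j = 0)%N.
  by case: (k i) ki ki1 => [//|[|n]] _; rewrite ?add1n ?addSn => -[].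
have kj j : j != i -> k j = 0%N.
  by move/eqP: k0; rewrite sum_nat_eq0 => /forallP/(_ j)/implyP H /H/eqP.
rewrite /monomial (bigD1 i)//= [RHS](bigD1 i)//= kiE expr1 mul1r.
rewrite big1 ?mulr1 => [|j /kj ->]; last by rewrite expr0.
by rewrite big1 ?addr0// => j /kj ->; rewrite mul0r.
Qed.

(** Absolute convergence at the corner (r, ..., r) of a cube bounds all sums of |c k| r^|k| by one
    M. For |h| <= r and |k| >= N one has |h|^|k| <= r^|k| (|h| / r)^N, hence the constant M / r^N.
    In the maximum norm every monomial is at most |h|^|k|. The same [c] and [r] serve every
    order. *)
Lemma analytic_at_taylor (f : 'cV[R]_m -> R) (a : 'cV[R]_m) :
  analytic_at f a ->
  exists c (r : R), 0 < r /\ forall N, exists2 M, 0 <= M &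
    forall h, `|h| <= r ->
      `|f (a + h) - taylor_poly c N h| <= M * `|h| ^+ N.
Proof.
move=> [c /nbhs_norm0P[e /= e0 He]].
pose r := e / 2.
have r0 : 0 < r by rewrite divr_gt0.
have re : r < e by rewrite ltr_pdivrMr// mulr_natr mulr2n ltrDl.
pose h0 : 'cV[R]_m := const_mx r.
have h0r : `|h0| <= r.
  rewrite /Num.norm/= mx_normrE; apply/bigmax_leP; split; first exact: ltW.
  by move=> i _; rewrite mxE gtr0_norm.
have [cv0 _] := He h0 (le_lt_trans h0r re).
have [M0 [_ HM0]] := cvg_seq_bounded cv0.
pose M := `|M0| + 1.
have M_gt0 : 0 < M by rewrite ltr_wpDl.
have absM n : \sum_(k <- box_seq n) `|c k| * r ^+ mdegree k <= M.
  have /HM0/(_ n I) : M0 < M by rewrite (le_lt_trans (ler_norm _))// ltrDl.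
  apply: le_trans; rewrite box_sumE /=.
  under [X in _ <= `|X|]eq_bigr do
    rewrite normrM monomial_const normrX (gtr0_norm r0).
  exact: ler_norm.
exists c, r; split => // N; exists (M / r ^+ N).
  by rewrite divr_ge0 ?exprn_ge0// ltW.
move=> h hr.
have [_ cvh] := He h (le_lt_trans hr re).
have key n : (N <= n)%N ->
    `|box_sum (fun k => c k * monomial h k) n - taylor_poly c N h|
    <= M / r ^+ N * `|h| ^+ N.
  move=> Nn; rewrite box_sumE -(taylor_poly_box c h Nn).
  rewrite (bigID (fun k => (mdegree k < N)%N))/= addrAC subrr add0r.
  apply: le_trans (ler_norm_sum _ _ _) _.
  rewrite mulrAC -mulrA -expr_div_n.
  apply: le_trans (ler_wpM2r _ (absM n)); last first.
    by rewrite exprn_ge0// divr_ge0// ltW.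
  rewrite [X in _ <= X * _](bigID (fun k => (mdegree k < N)%N))/= mulrDl.
  apply: ler_wpDl.
    rewrite mulr_ge0 ?exprn_ge0 ?divr_ge0//; last exact: ltW.
    by apply: sumr_ge0 => k _; rewrite mulr_ge0// exprn_ge0// ltW.
  rewrite mulr_suml; apply: ler_sum => k; rewrite -leqNgt => Nk.
  rewrite normrM -mulrA ler_wpM2l//.
  apply: le_trans (normr_monomial h k) _.
  rewrite -(subnKC Nk) !exprD mulrC -mulrA.
  have -> : r ^+ N * (r ^+ (mdegree k - N) * (`|h| / r) ^+ N) =
            r ^+ (mdegree k - N) * `|h| ^+ N.
    rewrite mulrCA -exprMn [r * _]mulrC divfK//; exact: lt0r_neq0.
  apply: ler_wpM2r; first exact: exprn_ge0.
  by rewrite lerXn2r ?nnegrE// ltW.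
have cvn : `|box_sum (fun k => c k * monomial h k) n - taylor_poly c N h|
    @[n --> \oo] --> `|f (a + h) - taylor_poly c N h|.
  by apply: cvg_norm; apply: cvgB => //; exact: cvg_cst.
apply: (cvgr_to_le cvn); exists N => // n /= Nn; exact: key.
Qed.

(** At order 1 the Taylor polynomial is its constant term, identified with f a at h = 0. The
    estimate supplies the continuity from which measurability of [theta] is derived. *)
Lemma analytic_at_lipschitz (f : 'cV[R]_m -> R) (a : 'cV[R]_m) :
  analytic_at f a -> exists r C : R, 0 < r /\
    forall h, `|h| <= r -> `|f (a + h) - f a| <= C * `|h|.
Proof.
move=> /analytic_at_taylor[c [r [r0 /(_ 1%N)[M M0 HM]]]].
exists r, M; split => // h hr.
have taylor1 h' : taylor_poly c 1 h' = taylor_poly c 1 0.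
  by apply: eq_bigr => k; rewrite ltnS leqn0 => /eqP k0; rewrite !monomial_degree0.
have := HM 0; rewrite normr0 expr1 mulr0 addr0 => /(_ (ltW r0)).
rewrite normr_le0 subr_eq0 => /eqP ->.
by rewrite -(taylor1 h) -[X in _ * X]expr1; exact: HM.
Qed.

(** The degree i part of the Taylor polynomial takes the sign (-1)^i under h -> -h. Up to a cubic
    remainder, the even part keeps degree 2, since degree 0 vanishes with f 0, and the odd part
    keeps degree 1. *)
Lemma analytic_at0_even_odd (f : 'cV[R]_m -> R) :
  analytic_at f 0 -> f 0 = 0 -> exists (l : 'I_m -> R) (r C : R),
    [/\ 0 < r, 0 <= C & forall h, `|h| <= r ->
      `|(f h + f (- h)) / 2| <= C * `|h| ^+ 2 /\
      `|(f h - f (- h)) / 2 - \sum_(i < m) l i * h i 0| <= C * `|h| ^+ 3].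
Proof.
move=> /analytic_at_taylor[c [r [r0 /(_ 3)[M M0 HM]]]] f0.
pose p i h := \sum_(k <- box_seq 3 | mdegree k == i) c k * monomial h k.
have pE h : taylor_poly c 3 h = p 0%N h + p 1%N h + p 2%N h.
  rewrite /taylor_poly (bigID (fun k => mdegree k == 2))/= addrC; congr (_ + _).
    rewrite (bigID (fun k => mdegree k == 1%N))/= addrC; congr (_ + _).
      by apply: eq_bigl => k; case: (mdegree k) => [|[|[|]]].
    by apply: eq_bigl => k; case: (mdegree k) => [|[|[|]]].
  by apply: eq_bigl => k; case: (mdegree k) => [|[|[|]]].
have pN i h : p i (- h) = (-1) ^+ i * p i h.
  by rewrite /p mulr_sumr; apply: eq_bigr => k /eqP <-; rewrite monomialN mulrCA.
have p_le i h : `|p i h| <= (\sum_(k <- box_seq 3) `|c k|) * `|h| ^+ i.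
  apply: le_trans (ler_norm_sum _ _ _) _.
  rewrite mulr_suml [leRHS](bigID (fun k => mdegree k == i))/=.
  apply: ler_wpDr.
    by apply: sumr_ge0 => k _; rewrite mulr_ge0// exprn_ge0.
  apply: ler_sum => k /eqP <-; rewrite normrM ler_wpM2l//.
  exact: normr_monomial.
have p0 h : p 0%N h = 0.
  have -> : p 0%N h = p 0%N 0.
    by apply: eq_bigr => k /eqP k0; rewrite !monomial_degree0.
  have := HM 0; rewrite normr0 expr0n mulr0 addr0 f0 => /(_ (ltW r0)).
  rewrite normr_le0 sub0r oppr_eq0 pE => /eqP.
  have p10 : p 1%N 0 = 0.
    by have := p_le 1%N 0; rewrite normr0 expr0n mulr0 normr_le0 => /eqP.
  have p20 : p 2%N 0 = 0.
    by have := p_le 2%N 0; rewrite normr0 expr0n mulr0 normr_le0 => /eqP.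
  by rewrite p10 p20 !addr0.
pose K := \sum_(k <- box_seq 3) `|c k|.
have K0 : 0 <= K by exact: sumr_ge0.
(* In degree 1, k j is 1 for a single j and 0 otherwise, so the sum picks the coefficient of h j. In
   the constant, [K] bounds the quadratic part, [M * r] turns the cubic remainder of the even part
   into a multiple of |h|^2, and [M] bounds that of the odd part. *)
exists (fun j => \sum_(k <- box_seq 3 | mdegree k == 1%N) c k * (k j)%:R), r,
  (K + M * r + M).
split => //; first by rewrite !addr_ge0 ?mulr_ge0// ltW.
move=> h hr.
have -> : \sum_(i < m) (\sum_(k <- box_seq 3 | mdegree k == 1%N)
    c k * (k i)%:R) * h i 0 = p 1%N h.
  under eq_bigr do rewrite mulr_suml.
  rewrite exchange_big/=; apply: eq_bigr => k /eqP k1.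
  rewrite monomial_degree1// mulr_sumr; apply: eq_bigr => i _.
  by rewrite mulrA.
have Hp := HM h hr.
have Hm : `|f (- h) - taylor_poly c 3 (- h)| <= M * `|h| ^+ 3.
  by have := HM (- h); rewrite normrN add0r; apply.
rewrite add0r in Hp.
move: Hp Hm; rewrite !pE !pN !p0 !add0r expr1 sqrrN expr1n !mul1r !mulN1r ?sub0r.
set u := f h; set v := f (- h); set P1 := p 1%N h; set P2 := p 2%N h.
have P2_le : `|P2| <= K * `|h| ^+ 2 by exact: p_le.
move=> Hu Hv.
have h3 : M * `|h| ^+ 3 <= M * r * `|h| ^+ 2.
  rewrite -mulrA ler_wpM2l// exprS ler_wpM2r// exprn_ge0//.
have h20 : 0 <= M * `|h| ^+ 2 by rewrite mulr_ge0// exprn_ge0.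
have h30 : 0 <= K * `|h| ^+ 3 by rewrite mulr_ge0// exprn_ge0.
have h31 : 0 <= M * r * `|h| ^+ 3 by rewrite !mulr_ge0 ?exprn_ge0// ltW.
have half (x : R) : `|x / 2| = `|x| / 2 by rewrite normrM [`|2^-1|]ger0_norm.
have He := ler_normD ((u - (P1 + P2)) / 2) ((v - (- P1 + P2)) / 2).
have Ho := ler_normB ((u - (P1 + P2)) / 2) ((v - (- P1 + P2)) / 2).
rewrite !half in He Ho; clearbody u v P1 P2 K.
move: Hu Hv h3 h20 h30 h31 P2_le He Ho; move: (`|h| ^+ 2) (`|h| ^+ 3) => q c3.
move=> Hu Hv h3 h20 h30 h31 P2_le He Ho; split.
  have -> : (u + v) / 2 = (u - (P1 + P2)) / 2 + (v - (- P1 + P2)) / 2 + P2 by lra.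
  apply: le_trans (ler_normD _ _) _. lra.
have -> : (u - v) / 2 - P1 = (u - (P1 + P2)) / 2 - (v - (- P1 + P2)) / 2 by lra.
lra.
Qed.

End power_series.

(** * Local expansion and measurability of analytic maps *)

Section analytic_maps.
Context (R : realType) (m : nat).
Implicit Types (h : 'cV[R]_m).

Lemma derive_at0_quadratic (f : 'cV[R]_m -> R) (l : 'I_m -> R) (r C : R)
    (j : 'I_m) :
  0 < r -> f 0 = 0 ->
  (forall h, `|h| <= r -> `|f h - \sum_(i < m) l i * h i 0| <= C * `|h| ^+ 2) ->
  'D_(delta_mx j 0) f 0 = l j.
Proof.
move=> r0 f0 H; apply/cvg_lim => //; apply/cvgrPdist_le => e e0.
have nd : `|delta_mx j 0 : 'cV[R]_m| <= 1.
  rewrite /Num.norm/= mx_normrE; apply/bigmax_leP; split => // i _.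
  by rewrite mxE; case: (_ && _); rewrite ?normr1 ?normr0.
near=> t.
have t0 : t != 0 by near: t; exact: nbhs_dnbhs_neq.
have tr : `|t| <= r by near: t; apply: dnbhs0_le.
have te : (`|C| + 1) * `|t| <= e.
  rewrite mulrC -ler_pdivlMr ?ltr_wpDl//; near: t; apply: dnbhs0_le.
  by rewrite divr_gt0// ltr_wpDl.
have th : `|t *: delta_mx j 0 : 'cV[R]_m| <= `|t|.
  by rewrite normrZ ler_piMr.
have := H (t *: delta_mx j 0) (le_trans th tr).
rewrite /= addr0 f0 subr0.
have -> : \sum_(i < m) l i * (t *: delta_mx j 0 : 'cV[R]_m) i 0 = t * l j.
  rewrite (bigD1 j)//= big1 ?addr0 => [|i ij]; first by rewrite !mxE !eqxx mulr1 mulrC.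
  by rewrite !mxE (negbTE ij) mulr0 mulr0.
move: (f _) => y Hy.
have -> : l j - t^-1 *: y = - (t^-1 * (y - t * l j)).
  by rewrite /GRing.scale/= mulrBr mulrA mulVf// mul1r opprB.
rewrite normrN normrM normfV mulrC ler_pdivrMr ?normr_gt0//.
apply: (le_trans Hy); apply: le_trans (ler_wpM2r (normr_ge0 t) te).
rewrite -mulrA; apply: (@le_trans _ _ (`|C| * (`|t| * `|t|))).
  apply: le_trans (ler_norm _) _; rewrite normrM; apply: ler_wpM2l => //.
  by rewrite normrX normr_id expr2 ler_pM.
by apply: ler_wpM2r; rewrite ?lerDl// mulr_ge0.
Unshelve. all: by end_near. Qed.

Section local_expansion.
Variable theta : 'cV[R]_m -> 'cV[R]_m.
Hypotheses (theta_analytic : analytic theta) (theta0 : theta 0 = 0).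

Let L h i : R := (jacobian_cV theta 0 *m h) i 0.
Let even h i : R := (theta h i 0 + theta (- h) i 0) / 2.
Let odd h i : R := (theta h i 0 - theta (- h) i 0) / 2.

Lemma even_odd_expansion i : exists (r C : R), [/\ 0 < r, 0 <= C &
  forall h, `|h| <= r ->
    `|even h i| <= C * `|h| ^+ 2 /\ `|odd h i - L h i| <= C * `|h| ^+ 3].
Proof.
have thi0 : theta 0 i 0 = 0 by rewrite theta0 mxE.
have [l [r [C [r0 C0 H]]]] := analytic_at0_even_odd (theta_analytic 0 i) thi0.
exists r, C; split => // h hr.
have [He Ho] := H h hr; split => //.
suff -> : L h i = \sum_(j < m) l j * h j 0 by [].
rewrite /L mxE; apply: eq_bigr => j _; congr (_ * _).
(* The even and odd parts add up to theta, so the linear form has error C |h|^2 + C |h|^3 <= (C + C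
   r) |h|^2, which identifies its coefficients with partial derivatives. *)
rewrite mxE; apply: (@derive_at0_quadratic _ _ r (C + C * r)) => // h' hr'.
have [He' Ho'] := H h' hr'.
have -> : theta h' i 0 - \sum_(i0 < m) l i0 * h' i0 0 =
  (theta h' i 0 + theta (- h') i 0) / 2 +
  ((theta h' i 0 - theta (- h') i 0) / 2 - \sum_(i0 < m) l i0 * h' i0 0) by lra.
apply: le_trans (ler_normD _ _) _; rewrite [leRHS]mulrDl; apply: lerD => //.
apply: (le_trans Ho'); rewrite -mulrA ler_wpM2l// exprS ler_wpM2r//.
Qed.

(** In the average over h and -h the even-odd cross products, of order |h|^3, cancel; even_i even_j
    + odd_i odd_j remains. This is where order 4, and with it tr(S)^2, comes from. *)
Lemma symmetrized_product_expansion : exists (r C : R), [/\ 0 < r, 0 <= C &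
  forall h, `|h| <= r -> forall i j,
    `|(theta h i 0 * theta h j 0 + theta (- h) i 0 * theta (- h) j 0) / 2
      - L h i * L h j| <= C * `|h| ^+ 4].
Proof.
have /choice[rC HrC] (i : 'I_m) : exists rC : R * R, [/\ 0 < rC.1, 0 <= rC.2 &
    forall h, `|h| <= rC.1 -> `|even h i| <= rC.2 * `|h| ^+ 2 /\
                              `|odd h i - L h i| <= rC.2 * `|h| ^+ 3].
  by have [r [C ?]] := even_odd_expansion i; exists (r, C).
(* The starting value 1 keeps [r] positive when m = 0. *)
pose r := \big[Num.min/1]_(i < m) (rC i).1.
pose C := \sum_(i < m) (rC i).2.
pose K := \sum_(i < m) \sum_(j < m) `|jacobian_cV theta 0 i j|.
have r0 : 0 < r.
  by rewrite /r; apply/bigmin_gtP; split => // i _; case: (HrC i).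
have C0 : 0 <= C by apply: sumr_ge0 => i _; case: (HrC i).
have K0 : 0 <= K by apply: sumr_ge0 => i _; exact: sumr_ge0.
have rr i : r <= (rC i).1 by exact: bigmin_le_cond.
have CC i : (rC i).2 <= C.
  by rewrite /C (bigD1 i)//= lerDl sumr_ge0// => j _; case: (HrC j).
have LK h i : `|L h i| <= K * `|h|.
  rewrite /L mxE; apply: le_trans (ler_norm_sum _ _ _) _.
  apply: (@le_trans _ _ ((\sum_(j < m) `|jacobian_cV theta 0 i j|) * `|h|)).
    rewrite mulr_suml; apply: ler_sum => j _; rewrite normrM ler_wpM2l//.
    exact: normr_coord_le.
  rewrite ler_wpM2r// /K [leRHS](bigD1 i)//= lerDl sumr_ge0// => k _.
  exact: sumr_ge0.
(* The three summands bound even_i even_j, (odd_i - L_i) odd_j and L_i (odd_j - L_j). *)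
exists r, (C ^+ 2 + (K + C * r ^+ 2) * C + K * C); split => //.
  by rewrite !addr_ge0 ?exprn_ge0// !mulr_ge0// addr_ge0// mulr_ge0// exprn_ge0// ltW.
move=> h hr i j.
have E k : `|even h k| <= C * `|h| ^+ 2.
  have [_ _ /(_ h (le_trans hr (rr k)))[H _]] := HrC k.
  by apply: (le_trans H); rewrite ler_wpM2r// exprn_ge0.
have O k : `|odd h k - L h k| <= C * `|h| ^+ 3.
  have [_ _ /(_ h (le_trans hr (rr k)))[_ H]] := HrC k.
  by apply: (le_trans H); rewrite ler_wpM2r// exprn_ge0.
have O' k : `|odd h k| <= (K + C * r ^+ 2) * `|h|.
  rewrite -[odd h k](subrK (L h k)); apply: le_trans (ler_normD _ _) _.
  rewrite addrC [leRHS]mulrDl; apply: lerD => //; apply: (le_trans (O k)).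
  rewrite exprSr mulrA ler_wpM2r// ler_wpM2l// lerXn2r ?nnegrE//; exact: ltW.
have -> : (theta h i 0 * theta h j 0 + theta (- h) i 0 * theta (- h) j 0) / 2
      - L h i * L h j = even h i * even h j +
   ((odd h i - L h i) * odd h j + L h i * (odd h j - L h j)).
  by rewrite /even /odd; field.
rewrite [leRHS]mulrDl [X in _ <= X + _]mulrDl -addrA.
apply: le_trans (ler_normD _ _) _; apply: lerD.
  rewrite normrM; apply: le_trans (ler_pM _ _ (E i) (E j)) _ => //.
  by rewrite mulrACA -expr2 -exprD.
apply: le_trans (ler_normD _ _) _; apply: lerD.
  rewrite normrM mulrC; apply: le_trans (ler_pM _ _ (O' j) (O i)) _ => //.
  by rewrite mulrACA -exprS.
rewrite normrM; apply: le_trans (ler_pM _ _ (LK h i) (O j)) _ => //.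
by rewrite mulrACA -exprS.
Qed.

End local_expansion.

(* A continuous map is a pointwise limit of maps composed with the rounding
   to a grid, which takes countably many values. *)
Lemma measurable_cV_continuous (f : 'cV[R]_m -> R) :
  (forall a, exists r C : R, 0 < r /\
    forall h, `|h| <= r -> `|f (a + h) - f a| <= C * `|h|) ->
  measurable_cV f.
Proof.
move=> flip; rewrite /measurable_cV.
pose q (n : nat) (v : 'cV[R]_m) : 'cV[R]_m :=
  \col_i ((Num.floor (n.+1%:R * v i 0))%:~R / n.+1%:R).
have qd n v : `|q n v - v| <= n.+1%:R^-1.
  rewrite /Num.norm/= mx_normrE; apply/bigmax_leP; split => // -[i k] _ /=.
  rewrite (ord1 k) !mxE distrC ger0_norm.
    rewrite -(ler_pM2l (_ : 0 < n.+1%:R)) ?ltr0Sn// mulfV ?pnatr_eq0//.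
    rewrite mulrBr mulrCA mulfV ?pnatr_eq0// mulr1.
    by have := ltW (floorD1_gt (n.+1%:R * v i 0)); rewrite intrD; lra.
  rewrite subr_ge0 ler_pdivrMr ?ltr0Sn// mulrC; exact: floor_le.
apply: (measurable_fun_cvg (h := fun n => (f \o q n) \o @cV_of_tuple R m)) => [n|t _].
  move=> _ A mA; rewrite setTI.
  pose g (k : m.-tuple int) : 'cV[R]_m := \col_i ((tnth k i)%:~R / n.+1%:R).
  pose S (k : m.-tuple int) : set (m.-tuple R) := [set t | forall i,
    [set x : R | (tnth k i)%:~R <= n.+1%:R * x < (tnth k i + 1)%:~R] (tnth t i)].
  have mS k : measurable (S k).
    rewrite /S (_ : mkset _ = \bigcap_(i in [set: 'I_m]) ((@tnth _ _ ^~ i) @^-1`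
        [set x : R | (tnth k i)%:~R <= n.+1%:R * x < (tnth k i + 1)%:~R])).
      apply: fin_bigcap_measurable => // i _.
      rewrite -[X in measurable X]setTI; apply: measurable_tnth => //.
      rewrite (_ : mkset _ = (fun x : R => n.+1%:R * x) @^-1`
          `[(tnth k i)%:~R, (tnth k i + 1)%:~R[%classic).
        have mf : measurable_fun [set: R] (fun x : R => n.+1%:R * x).
          exact: measurable_funM.
        by rewrite -[X in measurable X]setTI; apply: mf.
      by apply/seteqP; split => x /=; rewrite in_itv.
    by apply/seteqP; split => [t H i _|t H i]; exact: H.
  (* On a cell [S k] the rounded map takes the single value f (g k), so the preimage is a union of
     whole cells, indexed by the countable set of integer tuples. *)
  rewrite (_ : _ @^-1` A = \bigcup_k [set t | A (f (g k)) /\ S k t]).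
    apply: countable_bigcupT_measurable => [|k]; first exact: countableP.
    have [Ak|Ak] := pselect (A (f (g k))).
      by rewrite (_ : mkset _ = S k)//; apply/seteqP; split => [t []|t].
    by rewrite (_ : mkset _ = set0)//; apply/seteqP; split => [t []|t].
  have gq k t : S k t -> q n (cV_of_tuple t) = g k.
    move=> Skt; apply/colP => i; rewrite !mxE; congr (_%:~R / _).
    exact: floor_def (Skt i).
  apply/seteqP; split => [t /= At|t [k _ [Ak Skt]]]; last first.
    by rewrite /= (gq k).
  pose k := [tuple Num.floor (n.+1%:R * tnth t i) | i < m].
  have Skt : S k t.
    by move=> i; rewrite /= tnth_mktuple; rewrite floor_le ?floorD1_gt.
  by exists k => //=; rewrite -(gq k t).
have [r [C [r0 HC]]] := flip (cV_of_tuple t).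
apply/cvgrPdist_le => e e0 /=.
pose v := cV_of_tuple t.
have n_small (d : R) : 0 < d -> \forall n \near \oo, n.+1%:R^-1 <= d.
  move=> d0; have := @cvg_harmonic R; move/cvgr0Pnorm_le/(_ _ d0).
  by apply: filterS => n; rewrite ger0_norm ?invr_ge0.
have C0 : 0 < `|C| + 1 by rewrite ltr_wpDl.
near=> n.
have nr : n.+1%:R^-1 <= r by near: n; exact: n_small.
have ne : n.+1%:R^-1 <= e / (`|C| + 1) by near: n; apply: n_small; rewrite divr_gt0.
have qv := qd n v.
have := HC (q n v - v) (le_trans qv nr); rewrite -/v [v + _]addrC subrK distrC.
move=> /le_trans; apply.
apply: (@le_trans _ _ ((`|C| + 1) * `|q n v - v|)).
  by rewrite ler_wpM2r// (le_trans (ler_norm _))// lerDl.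
rewrite mulrC -ler_pdivlMr//; exact: le_trans qv ne.
Unshelve. all: by end_near. Qed.

Lemma measurable_cV_analytic (theta : 'cV[R]_m -> 'cV[R]_m) i :
  analytic theta -> measurable_cV (fun v => theta v i 0).
Proof.
move=> an; apply: measurable_cV_continuous => a.
exact: analytic_at_lipschitz (an a i).
Qed.

End analytic_maps.

(** * Quadratic forms *)

Section sqn_theory.
Context (R : realType).

(** Symmetrizing the double sum on the right reduces the claim termwise to (a i z j - a j z i)^2 >=
    0. *)
Lemma cauchy_schwarz_sum (m : nat) (a z : 'I_m -> R) :
  (\sum_i a i * z i) ^+ 2 <= (\sum_i a i ^+ 2) * (\sum_i z i ^+ 2).
Proof.
have -> : (\sum_i a i ^+ 2) * (\sum_i z i ^+ 2) =
    \sum_i \sum_j (a i ^+ 2 * z j ^+ 2 + a j ^+ 2 * z i ^+ 2) / 2.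
  under [RHS]eq_bigr do rewrite -mulr_suml big_split/= -mulr_sumr -mulr_suml.
  by rewrite -mulr_suml big_split/= -mulr_suml -mulr_sumr; field.
rewrite expr2 mulr_suml; apply: ler_sum => i _.
rewrite mulr_sumr; apply: ler_sum => j _.
have := sqr_ge0 (a i * z j - a j * z i); nra.
Qed.

Lemma gram_trace_ge0 (m n : nat) (A : 'M[R]_(m, n)) : 0 <= \tr (A *m A^T).
Proof.
apply: sumr_ge0 => i _; rewrite mxE; apply: sumr_ge0 => j _.
by rewrite mxE -expr2 sqr_ge0.
Qed.

(** tr(A A^T) is the squared Frobenius norm of [A]; Cauchy-Schwarz is applied row by row. *)
Lemma sqn_mulmx_le (m n : nat) (A : 'M[R]_(m, n)) (z : 'cV[R]_n) :
  sqn (A *m z) <= \tr (A *m A^T) * sqn z.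
Proof.
rewrite /sqn /mxtrace mulr_suml; apply: ler_sum => i _.
rewrite !mxE; under [X in _ <= X * _]eq_bigr do rewrite mxE -expr2.
exact: cauchy_schwarz_sum.
Qed.

Context (m : nat).
Implicit Types (A S : 'M[R]_m) (v : 'cV[R]_m).

Lemma sqnE v : sqn v = (v^T *m v) 0 0.
Proof. by rewrite mxE; apply: eq_bigr => i _; rewrite mxE expr2. Qed.

Lemma sqnZ (c : R) v : sqn (c *: v) = c ^+ 2 * sqn v.
Proof. by rewrite /sqn mulr_sumr; apply: eq_bigr => i _; rewrite mxE exprMn. Qed.

Lemma quadratic_form_sqn A v : (v^T *m (A *m A^T) *m v) 0 0 = sqn (A^T *m v).
Proof. by rewrite sqnE trmx_mul trmxK !mulmxA. Qed.

Lemma normr_le_sqn v : `|v| ^+ 2 <= sqn v.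
Proof.
have [->|v0] := eqVneq `|v| 0; first by rewrite expr0n sqn_ge0.
have [[i k] /= vE] := mx_norm_neq0 v0.
rewrite /Num.norm/= vE (ord1 k) real_normK ?num_real//.
by rewrite /sqn (bigD1 i)//= lerDl sumr_ge0// => j _; exact: sqr_ge0.
Qed.

Lemma posdef_unitmx A S : A *m A^T = S -> posdef S -> A \in unitmx.
Proof.
move=> AS [_ Spos]; rewrite -row_free_unit; apply: inj_row_free => u uA.
apply/eqP; apply: contraT => u0.
have := Spos u^T; rewrite -AS quadratic_form_sqn -trmx_mul uA trmx0.
have -> : sqn (0 : 'cV[R]_m) = 0.
  by rewrite /sqn big1// => i _; rewrite mxE expr0n.
rewrite ltxx; apply; apply: contra u0 => /eqP/(congr1 trmx).
by rewrite trmxK trmx0 => ->.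
Qed.

Lemma posdef_diag_gt0 S (i : 'I_m) : posdef S -> 0 < S i i.
Proof.
move=> [_ /(_ (delta_mx i 0))].
rewrite trmx_delta -rowE -colE !mxE; apply.
apply/eqP => /colP/(_ i); rewrite !mxE !eqxx => /eqP; by rewrite oner_eq0.
Qed.

(** The index [i] witnesses m > 0; in dimension 0 the trace is 0. *)
Lemma posdef_trace_gt0 S (i : 'I_m) : posdef S -> 0 < \tr S.
Proof.
move=> pS; rewrite /mxtrace (bigD1 i)//= ltr_pwDl ?posdef_diag_gt0//.
by apply: sumr_ge0 => j _; apply: ltW; exact: posdef_diag_gt0.
Qed.

(** Cauchy-Schwarz against the vector of ones; by symmetry each diagonal entry of S^2 is a sum of
    squares that contains (S i i)^2. *)
Lemma sqr_trace_le S : S^T = S -> (\tr S) ^+ 2 <= m%:R * \tr (S *m S).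
Proof.
move=> symS; have := cauchy_schwarz_sum (fun=> 1) (fun i => S i i).
under eq_bigr do rewrite mul1r.
rewrite expr1n sumr_const card_ord => /le_trans; apply.
rewrite ler_wpM2l// /mxtrace; apply: ler_sum => i _.
rewrite mxE (bigD1 i)//= -expr2 lerDl sumr_ge0// => j _.
have -> : S j i = S i j by rewrite -[in LHS]symS mxE.
by rewrite -expr2 sqr_ge0.
Qed.

Lemma trace_sqr_ge0 S : S^T = S -> 0 <= \tr (S *m S).
Proof.
move=> symS; rewrite /mxtrace; apply: sumr_ge0 => i _; rewrite mxE.
apply: sumr_ge0 => j _.
have -> : S j i = S i j by rewrite -[in LHS]symS mxE.
by rewrite -expr2 sqr_ge0.
Qed.

Lemma mx_norm_le_entries n (M : 'M[R]_(m, n)) (e : R) :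
  0 <= e -> (forall i j, `|M i j| <= e) -> `|M| <= e.
Proof.
by move=> e0 Me; rewrite /Num.norm/= mx_normrE; apply/bigmax_leP.
Qed.

Lemma mx_entry_le_norm n (M : 'M[R]_(m, n)) i j : `|M i j| <= `|M|.
Proof.
by rewrite [leRHS]/Num.norm/= mx_normrE; apply: le_trans (le_bigmax _ _ (i, j)).
Qed.

Lemma gram_norm_le_trace A : `|A *m A^T| <= \tr (A *m A^T).
Proof.
have trE : \tr (A *m A^T) = \sum_(i < m) \sum_(j < m) A i j ^+ 2.
  by apply: eq_bigr => i _; rewrite mxE; apply: eq_bigr => j _; rewrite mxE expr2.
have row_le i : \sum_(k < m) A i k ^+ 2 <= \tr (A *m A^T).
  rewrite trE [leRHS](bigD1 i)//= lerDl; apply: sumr_ge0 => j _.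
  by apply: sumr_ge0 => k _; exact: sqr_ge0.
apply: mx_norm_le_entries; first exact: gram_trace_ge0.
move=> i j; rewrite mxE; apply: le_trans (ler_norm_sum _ _ _) _.
apply: (@le_trans _ _ (\sum_(k < m) (A i k ^+ 2 + A j k ^+ 2) / 2)).
  apply: ler_sum => k _; rewrite mxE ler_norml.
  have := sqr_ge0 (A i k - A j k); have := sqr_ge0 (A i k + A j k).
  by move=> h1 h2; apply/andP; split; nra.
rewrite -mulr_suml big_split/=.
have := row_le i; have := row_le j; lra.
Qed.

(* Passing from A^T to A: with y = A^-1 x and A^T v = y one has
   |y|^2 = <v, x> <= |v| |x|. *)
Lemma sqn_invmx_le A (s k : R) : A \in unitmx -> 0 < s -> 0 <= k ->
  (forall v, s * sqn v <= k * sqn (A^T *m v)) ->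
  forall x, s * sqn (invmx A *m x) <= k * sqn x.
Proof.
move=> uA s0 k0 H x; set y := invmx A *m x.
pose v := invmx A^T *m y.
have vy : A^T *m v = y by rewrite mulmxA mulmxV ?unitmx_tr// mul1mx.
have xy : A *m y = x by rewrite mulmxA mulmxV// mul1mx.
have yE : sqn y = \sum_i v i 0 * x i 0.
  rewrite sqnE -{1}vy trmx_mul trmxK -mulmxA xy mxE.
  by apply: eq_bigr => i _; rewrite mxE.
have yy : sqn y ^+ 2 <= sqn v * sqn x by rewrite yE; exact: cauchy_schwarz_sum.
have [->|y0] := eqVneq (sqn y) 0.
  by rewrite mulr0 mulr_ge0 ?sqn_ge0.
have y1 : 0 < sqn y by rewrite lt_neqAle eq_sym y0 sqn_ge0.
rewrite -(ler_pM2r y1) -mulrA -expr2.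
apply: (@le_trans _ _ (s * (sqn v * sqn x))); first by rewrite ler_pM2l.
rewrite mulrA; apply: le_trans (ler_wpM2r (sqn_ge0 x) (H v)) _.
by rewrite vy mulrAC.
Qed.

End sqn_theory.

(** * Error of the linearized covariance *)

Section covariance_error.
Local Open Scope ereal_scope.
Context (R : realType) (m : nat).
Context d (T : measurableType d) (P : probability T R).
Variable Z : 'I_m -> {RV P >-> R}.
Hypothesis normalZ : standard_normals Z.

Let bilinearE (B : 'M[R]_m) i j w :
  ((B *m rv_col Z w) i ord0 * (B *m rv_col Z w) j ord0)%:E =
  \sum_(k < m) \sum_(l < m) (B i k * B j l)%:E * (Z k w * Z l w)%:E.
Proof.
rewrite !mxE mulr_suml -sumEFin; apply: eq_bigr => k _.
rewrite mulr_sumr -sumEFin; apply: eq_bigr => l _.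
by rewrite -EFinM !mxE mulrACA.
Qed.

Lemma integrable_bilinear_normal (B : 'M[R]_m) i j :
  P.-integrable [set: T]
    (fun w => ((B *m rv_col Z w) i ord0 * (B *m rv_col Z w) j ord0)%:E).
Proof.
under eq_fun do rewrite bilinearE.
apply: integrable_sum => // k _; apply: integrable_sum => // l _.
by apply: integrableZl => //; exact: integrable_std_normal_mul.
Qed.

Lemma expectation_bilinear_normal (B : 'M[R]_m) i j :
  \int[P]_w ((B *m rv_col Z w) i ord0 * (B *m rv_col Z w) j ord0)%:E =
  ((B *m B^T) i j)%:E.
Proof.
have intZ k l := integrable_std_normal_mul normalZ k l.
under eq_integral do rewrite bilinearE.
rewrite integral_sum//; last first.
  move=> k; apply: integrable_sum => // l _; exact: integrableZl.
rewrite mxE -sumEFin; apply: eq_bigr => k _.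
rewrite integral_sum//; last by move=> l; exact: integrableZl.
rewrite (bigD1 k)//= integralZl// expectation_std_normal_mul// eqxx mule1 mxE.
rewrite big1 ?adde0// => l lk.
by rewrite integralZl// expectation_std_normal_mul// eq_sym (negbTE lk) mule0.
Qed.

Lemma expectation_sqn2_mulmx_le (A : 'M[R]_m) :
  \int[P]_w (sqn (A *m rv_col Z w) ^+ 2)%:E <=
  ((\tr (A *m A^T)) ^+ 2 * normal_fourth_moment_bound R m)%:E.
Proof.
have mS : measurable_fun [set: T] (fun w => sqn (rv_col Z w)).
  by apply: (measurable_cV_comp (@measurable_sqn R m)); exact: measurable_rv_col.
have mSA : measurable_fun [set: T] (fun w => sqn (A *m rv_col Z w)).
  apply: (measurable_cV_comp (@measurable_sqn R m)) => i.
  by apply: measurable_mulmx => j; exact: measurable_rv_col.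
rewrite EFinM; apply: le_trans (lee_wpmul2l _ (expectation_sqn2_le normalZ)).
  rewrite -ge0_integralZl//; last 3 first.
  - by apply/measurable_EFinP; exact: measurable_funX.
  - by move=> w _; rewrite lee_fin sqr_ge0.
  - by rewrite lee_fin sqr_ge0.
  apply: ge0_le_integral => //.
  - by move=> w _; rewrite lee_fin sqr_ge0.
  - by apply/measurable_EFinP; exact: measurable_funX.
  - apply/measurable_EFinP; apply: measurable_funM => //; exact: measurable_funX.
  - move=> w _; rewrite -EFinM lee_fin -exprMn lerXn2r ?nnegrE ?sqn_ge0//.
      by rewrite (le_trans (sqn_ge0 (A *m rv_col Z w)))// sqn_mulmx_le.
    exact: sqn_mulmx_le.
by rewrite lee_fin sqr_ge0.
Qed.

Variable theta : 'cV[R]_m -> 'cV[R]_m.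
Hypothesis theta_analytic : analytic theta.

(* rho bounds the squared Euclidean norm. *)
Definition tail_sqn (rho : R) (v : 'cV[R]_m) : R :=
  (sqn (theta v) * \1_`]rho, +oo[ (sqn v))%R.

Lemma tail_sqn_ge0 rho v : (0 <= tail_sqn rho v)%R.
Proof. by rewrite mulr_ge0// sqn_ge0. Qed.

Lemma measurable_sqn_analytic : measurable_cV (fun v => sqn (theta v)).
Proof.
apply: (measurable_cV_comp (@measurable_sqn R m)) => i.
exact: measurable_cV_analytic.
Qed.

Lemma measurable_tail_sqn rho : measurable_cV (tail_sqn rho).
Proof.
apply: measurable_funM; first exact: measurable_sqn_analytic.
by apply: measurableT_comp => //; exact: measurable_sqn.
Qed.

Let J := jacobian_cV theta 0%R.

(** Averaging theta_i theta_j over x and -x keeps the expectation and makes the fourth-order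
    estimate applicable. Beyond the radius, the products of theta are left to [tail_sqn], and the
    quadratic form is at most tr(J J^T) |x|^2 <= (tr(J J^T) / r^2) |x|^4 in the Euclidean norm. *)
Lemma covariance_entry_error (r C : R) (A : 'M[R]_m) (tau : R) i j :
  (0 < r)%R -> (0 <= C)%R ->
  (forall h : 'cV[R]_m, `|h| <= r -> forall i j,
    `|(theta h i 0 * theta h j 0 + theta (- h) i 0 * theta (- h) j 0) / 2
      - (J *m h) i 0 * (J *m h) j 0| <= C * `|h| ^+ 4)%R ->
  covariance_well_defined P (theta \o (fun w => A *m rv_col Z w)%R) ->
  \int[P]_w (tail_sqn (r ^+ 2) (A *m rv_col Z w))%:E <= tau%:E ->
  (`|(covariance_mx P (theta \o (fun w => A *m rv_col Z w)) -
     J *m (A *m A^T) *m J^T) i j| <=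
   (C + \tr (J *m J^T) / r ^+ 2) * ((\tr (A *m A^T)) ^+ 2 *
      normal_fourth_moment_bound R m) + tau)%R.
Proof.
move=> r0 C0 Hloc wd Htau.
pose x w := (A *m rv_col Z w)%R.
pose p v : R := (theta v i 0 * theta v j 0)%R.
pose D := (C + \tr (J *m J^T) / r ^+ 2)%R.
have pE w : ((theta (x w) *m (theta (x w))^T) i j = p (x w))%R.
  by rewrite mxE big_ord1 !mxE.
have mx k : measurable_fun [set: T] (fun w => x w k 0%R).
  by apply: measurable_mulmx => l; exact: measurable_rv_col.
have mp : measurable_cV p.
  by apply: measurable_funM; exact: measurable_cV_analytic.
have ip : P.-integrable [set: T] (fun w => (p (x w))%:E).
  by apply: eq_integrable (wd i j) => // w _ /=; rewrite pE.
pose e : 'cV[R]_m := const_mx (-1)%R.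
have reflect (g : 'cV[R]_m -> R) : measurable_cV g ->
    \int[P]_w (g (x w))%:E = \int[P]_w (g (- x w))%R%:E.
  move=> mg; rewrite (expectation_reflection normalZ (e := e)
    (g := fun z => g (A *m z)%R)).
  - apply: eq_integral => w _; congr (g _)%:E; rewrite -mulmxN; congr (_ *m _)%R.
    by apply/colP => k; rewrite !mxE mulN1r.
  - by move=> k; rewrite mxE normrN normr1.
  - exact: measurable_cV_mulmx.
have mxN k : measurable_fun [set: T] (fun w => (- x w)%R k 0%R).
  by under eq_fun do rewrite mxE; exact: measurable_funN.
have ipN : P.-integrable [set: T] (fun w => (p (- x w)%R)%:E).
  apply/integrableP; split.
    by apply/measurable_EFinP; exact: (measurable_cV_comp mp).
  have /integrableP[_] := ip.
  rewrite [X in _ -> X < _](_ : _ = \int[P]_w (`|p (- x w)|%R)%:E)//.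
  rewrite -(reflect (fun v => `|p v|%R))//.
  exact: measurableT_comp.
pose q w : R := ((J *m x w) i ord0 * (J *m x w) j ord0)%R.
have qE w : q w = (((J *m A) *m rv_col Z w) i ord0 *
                   ((J *m A) *m rv_col Z w) j ord0)%R.
  by rewrite /q /x !mulmxA.
have iq : P.-integrable [set: T] (fun w => (q w)%:E).
  apply: eq_integrable (integrable_bilinear_normal (J *m A)%R i j) => // w _.
  by rewrite qE.
have Eq : \int[P]_w (q w)%:E = ((J *m (A *m A^T) *m J^T)%R i j)%:E.
  under eq_integral do rewrite qE.
  by rewrite expectation_bilinear_normal trmx_mul !mulmxA.
pose F w : R := ((p (x w) + p (- x w)) / 2 - q w)%R.
have Ep : \int[P]_w (p (x w))%:E \is a fin_num by exact: integrable_fin_num.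
pose I := fine (\int[P]_w (p (x w))%:E).
have IE : \int[P]_w (p (x w))%:E = I%:E by rewrite fineK.
have EF : \int[P]_w (F w)%:E =
    (covariance_mx P (theta \o x) i j - (J *m (A *m A^T) *m J^T)%R i j)%:E.
  have -> : covariance_mx P (theta \o x) i j = I.
    rewrite mxE /I unlock; congr fine; apply: eq_integral => w _.
    by rewrite /= pE.
  transitivity (\int[P]_w ((2^-1)%R%:E * ((p (x w))%:E + (p (- x w)%R)%:E) - (q w)%:E)).
    by apply: eq_integral => w _; rewrite /F mulrC EFinB EFinM EFinD.
  rewrite integralB//; last first.
    by apply: integrableZl => //; exact: integrableD.
  rewrite integralZl//; last exact: integrableD.
  rewrite integralD// -reflect// IE Eq EFinB; congr (_ - _).
  by rewrite -EFinD -EFinM; congr EFin; lra.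
have iF : measurable_fun [set: T] F.
  apply: measurable_funB.
    apply: measurable_funM => //; apply: measurable_funD; exact: (measurable_cV_comp mp).
  by apply/measurable_EFinP; case/integrableP : iq.
have mt : measurable_fun [set: T] (fun w => tail_sqn (r ^+ 2) (x w)).
  exact: (measurable_cV_comp (measurable_tail_sqn _)).
have mtN : measurable_fun [set: T] (fun w => tail_sqn (r ^+ 2) (- x w)).
  exact: (measurable_cV_comp (measurable_tail_sqn _)).
have ms2 : measurable_fun [set: T] (fun w => sqn (x w) ^+ 2)%R.
  by apply: measurable_funX; apply: (measurable_cV_comp (@measurable_sqn R m)).
have D0 : (0 <= D)%R.
  by rewrite addr_ge0// divr_ge0 ?sqr_ge0 ?gram_trace_ge0.
have sqnN v : sqn (- v : 'cV[R]_m)%R = sqn v.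
  by apply: eq_bigr => k _; rewrite mxE sqrrN.
have Fle w : (`|F w| <= D * sqn (x w) ^+ 2 +
    2^-1 * (tail_sqn (r ^+ 2) (x w) + tail_sqn (r ^+ 2) (- x w)))%R.
  rewrite /tail_sqn sqnN indicE mem_setE in_itv/= andbT.
  have x4 : (`|x w| ^+ 4 <= sqn (x w) ^+ 2)%R.
    by rewrite (exprM _ 2 2) lerXn2r ?nnegrE ?exprn_ge0 ?sqn_ge0// normr_le_sqn.
  have trJ0 : (0 <= \tr (J *m J^T) / r ^+ 2 * sqn (x w) ^+ 2)%R.
    by rewrite mulr_ge0 ?sqr_ge0// divr_ge0 ?sqr_ge0 ?gram_trace_ge0.
  have [rx|rx] := ltP (r ^+ 2)%R (sqn (x w)); last first.
    (* The cutoff is Euclidean while [Hloc] uses the maximum norm, which is smaller, so [Hloc]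
       covers everything below the cutoff. *)
    have xr : (`|x w| <= r)%R.
      rewrite -(@ler_pXn2r _ 2) ?nnegrE//; last exact: ltW.
      exact: le_trans (normr_le_sqn _) rx.
    rewrite !mulr0 addr0 mulr0 addr0; apply: (le_trans (Hloc _ xr i j)).
    by rewrite mulrDl; apply: ler_wpDr => //; rewrite ler_wpM2l.
  rewrite !mulr1.
  have coord2 (v : 'cV[R]_m) k : (v k 0 ^+ 2 <= sqn v)%R.
    by rewrite /sqn (bigD1 k)//= lerDl sumr_ge0// => l _; exact: sqr_ge0.
  have prod_le (v : 'cV[R]_m) : (`|v i 0 * v j 0| <= sqn v)%R.
    have := coord2 v i; have := coord2 v j.
    by rewrite ler_norml => h1 h2; apply/andP; split; nra.
  have q_le : (`|q w| <= \tr (J *m J^T) / r ^+ 2 * sqn (x w) ^+ 2)%R.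
    apply: le_trans (prod_le _) _; apply: le_trans (sqn_mulmx_le _ _) _.
    have r20 : (0 < r ^+ 2)%R by rewrite exprn_gt0.
    rewrite mulrAC -[leLHS](mulfK (lt0r_neq0 r20)) ler_pM2r ?invr_gt0//.
    rewrite -mulrA ler_wpM2l ?gram_trace_ge0//.
    by rewrite expr2 ler_wpM2l ?sqn_ge0// ltW.
  have C4 : (0 <= C * sqn (x w) ^+ 2)%R by rewrite mulr_ge0 ?sqr_ge0.
  have p1 := prod_le (theta (x w)); have p2 := prod_le (theta (- x w)%R).
  rewrite -/(p (x w)) in p1; rewrite -/(p (- x w)%R) in p2.
  apply: le_trans (ler_normB ((p (x w) + p (- x w)%R) / 2)%R (q w)) _.
  have := ler_normD (p (x w)) (p (- x w)%R).
  have half (a : R) : (`|a / 2| = `|a| / 2)%R by rewrite normrM [`|2^-1|%R]ger0_norm.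
  by rewrite half /D; lra.
pose t := (D * (\tr (A *m A^T) ^+ 2 * normal_fourth_moment_bound R m) + tau)%R.
have main : `|\int[P]_w (F w)%:E| <= t%:E.
  apply: le_trans (le_abse_integral _ measurableT _) _; first exact/measurable_EFinP.
  apply: (@le_trans _ _ (\int[P]_w (D%:E * (sqn (x w) ^+ 2)%:E +
      (2^-1)%R%:E * ((tail_sqn (r ^+ 2) (x w))%:E +
                     (tail_sqn (r ^+ 2) (- x w)%R)%:E)))).
    apply: ge0_le_integral => //.
    - by apply: measurableT_comp => //; exact/measurable_EFinP.
    - apply/measurable_EFinP; apply: measurable_funD; apply: measurable_funM => //.
      exact: measurable_funD.
    - by move=> w _; have := Fle w; rewrite -lee_fin EFinD !EFinM EFinD.
  have t0 v : 0 <= (tail_sqn (r ^+ 2) v)%:E by rewrite lee_fin tail_sqn_ge0.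
  have s0 w : 0 <= (sqn (x w) ^+ 2)%:E by rewrite lee_fin sqr_ge0.
  rewrite ge0_integralD//; last 4 first.
  - by move=> w _; rewrite mule_ge0.
  - by apply/measurable_EFinP; exact: measurable_funM.
  - by move=> w _; rewrite mule_ge0// adde_ge0.
  - apply/measurable_EFinP; apply: measurable_funM => //; exact: measurable_funD.
  rewrite ge0_integralZl//; last exact/measurable_EFinP.
  rewrite ge0_integralZl//; last 2 first.
  - by apply/measurable_EFinP; exact: measurable_funD.
  - by move=> w _; rewrite adde_ge0.
  rewrite ge0_integralD//; [|exact/measurable_EFinP|exact/measurable_EFinP].
  rewrite -(reflect (tail_sqn (r ^+ 2)))//; last exact: measurable_tail_sqn.
  rewrite [leRHS]EFinD [X in _ <= X + _]EFinM; apply: leeD.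
    by apply: lee_wpmul2l; [rewrite lee_fin|exact: expectation_sqn2_mulmx_le].
  have -> : tau%:E = (2^-1)%R%:E * (tau%:E + tau%:E).
    by rewrite -EFinD -EFinM; congr EFin; lra.
  by apply: lee_wpmul2l; [rewrite lee_fin|exact: (leeD Htau Htau)].
move: main; rewrite EF /= lee_fin; apply: le_trans.
by rewrite [X in (`|X| <= _)%R]mxE [X in (`|_ + X| <= _)%R]mxE.
Qed.

End covariance_error.

(** * Tail bounds and the expansion *)

Section expansion.
Context (R : realType).

(** From e^u >= u^(m + 2) / (m + 2)! at u = rho / s: of the m + 2 powers of s gained, m pay for s^-m
    and 2 remain. *)
Lemma exp_decay_le (m : nat) (rho : R) : 0 < rho -> exists2 C : R, 0 <= C &
  forall s, 0 < s -> s ^- m * expR (- (rho / s)) <= C * s ^+ 2.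
Proof.
move=> rho0; exists ((m.+2)`!%:R / rho ^+ m.+2).
  by rewrite divr_ge0// exprn_ge0// ltW.
move=> s s0; have u0 : 0 < rho / s by rewrite divr_gt0.
have H : (rho / s) ^+ m.+2 / (m.+2)`!%:R <= expR (rho / s).
  by have := @expR_ge1Dxn R (rho / s) m.+1 (ltW u0); lra.
have c0 : 0 < (rho / s) ^+ m.+2 / (m.+2)`!%:R.
  by rewrite divr_gt0 ?exprn_gt0// ltr0n fact_gt0.
have {}H : expR (- (rho / s)) <= ((rho / s) ^+ m.+2 / (m.+2)`!%:R)^-1.
  by rewrite expRN lef_pV2// posrE expR_gt0.
have sm : 0 <= s ^- m by rewrite invr_ge0 exprn_ge0// ltW.
apply: le_trans (ler_wpM2l sm H) _.
rewrite invf_div expr_div_n invf_div.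
have t0 : rho ^+ m.+2 != 0 by rewrite gt_eqF// exprn_gt0.
have sm0 : s ^+ m != 0 by rewrite gt_eqF// exprn_gt0.
have -> : s ^+ m.+2 = s ^+ m * s ^+ 2 by rewrite -exprD addn2.
move: (rho ^+ _) (_ `!)%:R (s ^+ m) t0 sm0 => t q u t0 u0'.
suff -> : u^-1 * (q * (u * s ^+ 2 / t)) = q / t * s ^+ 2 by [].
by field; rewrite u0' t0.
Qed.

Context (m : nat) (theta : 'cV[R]_m -> 'cV[R]_m).

Lemma expectation_sqn_well_defined d (T : measurableType d)
    (P : probability T R) (Y : T -> 'cV[R]_m) :
  covariance_well_defined P Y ->
  (\int[P]_w (sqn (Y w))%:E)%E = (\tr (covariance_mx P Y))%:E.
Proof.
move=> wd.
have YE w i : Y w i 0 ^+ 2 = (Y w *m (Y w)^T) i i.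
  by rewrite mxE big_ord1 mxE expr2.
under eq_integral do rewrite /sqn -sumEFin.
rewrite integral_sum//; last first.
  by move=> i; apply: eq_integrable (wd i i) => // w _ /=; rewrite YE.
rewrite /mxtrace -sumEFin; apply: eq_bigr => i _.
rewrite mxE unlock fineK; first by apply: eq_integral => w _; rewrite YE.
exact: integrable_fin_num (wd i i).
Qed.

Hypotheses (theta_analytic : analytic theta) (theta0 : theta 0 = 0).

(** Only the tail estimate depends on [K]; the rest is common to both claims. [G] and [s1] come
    before [S] because the expansion asks for one constant and one neighbourhood. *)
Lemma expansion_of_tail (K : set 'M[R]_m) :
  (forall rho : R, 0 < rho -> exists G s1 : R, [/\ 0 <= G, 0 < s1 &
    forall S : 'M[R]_m, K S -> posdef S -> 0 < \tr S -> \tr S < s1 ->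
    forall d (T : measurableType d) (P : probability T R) (A : 'M[R]_m)
      (Z : 'I_m -> {RV P >-> R}),
    A *m A^T = S -> standard_normals Z ->
    covariance_well_defined P (theta \o (fun w => A *m rv_col Z w)) ->
    (\int[P]_w (tail_sqn theta rho (A *m rv_col Z w))%:E <=
     (G * ((\tr S) ^- m * expR (- (rho / 4 / \tr S))))%:E)%E]) ->
  covariance_expansion_on theta K.
Proof.
move=> tail_bound.
have [r [C [r0 C0 Hloc]]] := symmetrized_product_expansion theta_analytic theta0.
have rho0 : 0 < r ^+ 2 by rewrite exprn_gt0.
have [G [s1 [G0 s10 Htail]]] := tail_bound _ rho0.
have [E E0 HE] := @exp_decay_le m (r ^+ 2 / 4) (divr_gt0 rho0 (ltr0Sn _ _)).
pose J := jacobian_cV theta 0.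
pose D := (C + \tr (J *m J^T) / r ^+ 2) * normal_fourth_moment_bound R m + G * E.
have k0 : 0 <= normal_fourth_moment_bound R m.
  by rewrite mulr_ge0// invr_ge0 exprn_ge0.
have D0 : 0 <= D.
  by rewrite addr_ge0 ?mulr_ge0// addr_ge0// divr_ge0 ?sqr_ge0 ?gram_trace_ge0.
(* The factor m is that of [sqr_trace_le]. As tr(S) <= m |S| in the maximum norm, the radius forces
   tr(S) < s1; m + 1 instead of m covers dimension 0. *)
exists (D * m%:R); apply/nbhs_norm0P; exists (s1 / m.+1%:R) => /=.
  by rewrite divr_gt0.
move=> S /= Ssmall KS pS d T P x [A [Z [AS NZ xE]]] wd.
have {xE} xE : x = fun w => A *m rv_col Z w by apply/funext.
rewrite {}xE in wd *.
have symS : S^T = S by case: pS.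
apply: mx_norm_le_entries; first by rewrite !mulr_ge0 ?trace_sqr_ge0.
move=> i j; have tr0 := posdef_trace_gt0 i pS.
have tr1 : \tr S < s1.
  have S0 : `|S| * m.+1%:R < s1 by rewrite -ltr_pdivlMr.
  apply: le_lt_trans S0; apply: (@le_trans _ _ (\sum_(k < m) `|S|)).
    apply: ler_sum => k _; exact: le_trans (ler_norm _) (mx_entry_le_norm S k k).
  by rewrite sumr_const card_ord -[leLHS]mulr_natr ler_wpM2l// ler_nat.
have tail := Htail S KS pS tr0 tr1 _ _ _ _ _ AS NZ wd.
have := covariance_entry_error NZ theta_analytic i j r0 C0 Hloc wd tail.
rewrite AS -/J => /le_trans; apply.
apply: (@le_trans _ _ (D * (\tr S) ^+ 2)); last first.
  by rewrite -mulrA ler_wpM2l// sqr_trace_le.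
rewrite /D [leRHS]mulrDl; apply: lerD; first by rewrite mulrA mulrAC.
by rewrite -[leRHS]mulrA ler_wpM2l// HE.
Qed.

End expansion.

(** * Tail bounds by comparison with a wider Gaussian *)

Section tails.
Context (R : realType) (m : nat) (theta : 'cV[R]_m -> 'cV[R]_m).
Hypothesis theta_analytic : analytic theta.

(** As A (B z) = A0 z, the comparison variable is A0 Z0, for which the second moment of theta is the
    trace of its covariance. On the tail event the density ratio is at most b^m e^u. *)
Lemma tail_comparison d (T : measurableType d) (P : probability T R)
    (Z : 'I_m -> {RV P >-> R}) d0 (T0 : measurableType d0)
    (P0 : probability T0 R) (Z0 : 'I_m -> {RV P0 >-> R})
    (A A0 B : 'M[R]_m) (b rho u : R) :
  standard_normals Z -> standard_normals Z0 ->
  covariance_well_defined P0 (theta \o (fun w => A0 *m rv_col Z0 w)) ->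
  A *m B = A0 -> B \in unitmx -> 0 < b ->
  (forall v, sqn (B *m v) <= b ^+ 2 * sqn v) ->
  (forall v, rho < sqn (A0 *m v) -> (sqn v - sqn (B *m v)) / 2 <= u) ->
  (\int[P]_w (tail_sqn theta rho (A *m rv_col Z w))%:E <=
   (b ^+ m * expR u *
    \tr (covariance_mx P0 (theta \o (fun w => A0 *m rv_col Z0 w))))%:E)%E.
Proof.
move=> NZ NZ0 wd AB uB b0 Bb Hu.
pose g v := tail_sqn theta rho (A *m v).
have mg : measurable_cV g.
  by apply: (@measurable_cV_mulmx _ _ A (tail_sqn theta rho)); exact: measurable_tail_sqn.
have g0 v : 0 <= g v by exact: tail_sqn_ge0.
apply: le_trans (gaussian_comparison NZ NZ0 uB b0 Bb mg g0) _.
rewrite -mulrA EFinM; apply: lee_wpmul2l; first by rewrite lee_fin exprn_ge0// ltW.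
rewrite EFinM -(expectation_sqn_well_defined wd).
have mz i : measurable_fun [set: T0] (fun w => rv_col Z0 w i 0).
  exact: measurable_rv_col.
have mBz i : measurable_fun [set: T0] (fun w => (B *m rv_col Z0 w) i 0).
  exact: measurable_mulmx.
have mth : measurable_fun [set: T0] (fun w => sqn (theta (A0 *m rv_col Z0 w))).
  apply: (measurable_cV_comp (measurable_sqn_analytic theta_analytic)) => i.
  exact: measurable_mulmx.
rewrite -ge0_integralZl//; last 2 first.
- exact/measurable_EFinP.
- by move=> w _; rewrite lee_fin sqn_ge0.
apply: ge0_le_integral => //.
- by move=> w _; rewrite lee_fin mulr_ge0// expR_ge0.
- apply/measurable_EFinP; apply: measurable_funM.
    exact: (measurable_cV_comp mg).
  apply: measurableT_comp => //; apply: measurable_funM => //.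
  by apply: measurable_funB; exact: (measurable_cV_comp (@measurable_sqn R m)).
- by apply/measurable_EFinP; exact: measurable_funM.
- move=> w _; rewrite -EFinM lee_fin /g /tail_sqn mulmxA AB.
  rewrite indicE mem_setE in_itv/= andbT mulrC.
  case: ltP => [/Hu h|_]; last by rewrite mulr0 mulr0 mulr_ge0 ?expR_ge0 ?sqn_ge0.
  by rewrite mulr1 ler_wpM2r ?sqn_ge0// ler_expR.
Qed.

(** Conditioning enters through |A^-1 y|^2 <= |kappa| |y|^2 / tr(S), which bounds B = A^-1 A0 from
    above. The exponent relies on the opposite bound |A0 z|^2 <= tr(S) |B z|^2, valid for every
    [S]. *)
Lemma tail_well_conditioned (kappa rho : R) : 0 < rho ->
  exists G s1 : R, [/\ 0 <= G, 0 < s1 &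
    forall S : 'M[R]_m, well_conditioned kappa S -> posdef S -> 0 < \tr S ->
      \tr S < s1 ->
    forall d (T : measurableType d) (P : probability T R) (A : 'M[R]_m)
      (Z : 'I_m -> {RV P >-> R}),
    A *m A^T = S -> standard_normals Z ->
    covariance_well_defined P (theta \o (fun w => A *m rv_col Z w)) ->
    (\int[P]_w (tail_sqn theta rho (A *m rv_col Z w))%:E <=
     (G * ((\tr S) ^- m * expR (- (rho / 4 / \tr S))))%:E)%E].
Proof.
move=> rho0.
(* The constants must be fixed before [S], so the comparison law is obtained by excluded middle
   rather than from [S]. *)
pose wit := exists (d0 : measure_display) (T0 : measurableType d0)
  (P0 : probability T0 R) (A0 : 'M[R]_m) (Z0 : 'I_m -> {RV P0 >-> R}),
  [/\ posdef (A0 *m A0^T), standard_normals Z0 &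
   covariance_well_defined P0 (theta \o (fun w => A0 *m rv_col Z0 w))].
have [[d0 [T0 [P0 [A0 [Z0 [pS0 NZ0 wd0]]]]]]|nwit] := pselect wit; last first.
  exists 0, 1; split => // S _ pS _ _ d T P A Z AS NZ wd.
  by exfalso; apply: nwit; exists d, T, P, A, Z; rewrite AS.
have uA0 := posdef_unitmx (erefl _) pS0.
set s0 := \tr (A0 *m A0^T).
have s00 : 0 <= s0 by exact: gram_trace_ge0.
pose K0 := \tr (invmx A0 *m (invmx A0)^T).
have K00 : 0 <= K0 by exact: gram_trace_ge0.
pose V := \tr (covariance_mx P0 (theta \o (fun w => A0 *m rv_col Z0 w))).
have V0 : 0 <= V.
  rewrite -lee_fin -(expectation_sqn_well_defined wd0).
  by apply: integral_ge0 => w _; rewrite lee_fin sqn_ge0.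
pose b1 := `|kappa| * s0 + 1.
have b10 : 0 < b1 by rewrite ltr_wpDl// mulr_ge0.
(* With 2 K0 s <= 1, |z|^2 <= K0 |A0 z|^2 and |B z|^2 >= |A0 z|^2 / s, the exponent is at most - |A0
   z|^2 / (4 s), hence - rho / (4 s) on the tail. The added 1 gives s < 1. *)
exists (b1 ^+ m * V), (2 * K0 + 1)^-1; split.
- by rewrite mulr_ge0// exprn_ge0// ltW.
- by rewrite invr_gt0 ltr_wpDl// mulr_ge0.
move=> S wc pS; set s := \tr S => spos ssmall d T P A Z AS NZ wd.
have uA := posdef_unitmx AS pS.
have K0s : (2 * K0 + 1) * s < 1.
  by rewrite mulrC -ltr_pdivlMr ?div1r// ltr_wpDl// mulr_ge0.
have sK0 : 0 <= K0 * s by rewrite mulr_ge0// ltW.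
have s1 : s < 1 by lra.
pose B := invmx A *m A0.
have AB : A *m B = A0 by rewrite mulmxA mulmxV// mul1mx.
have uB : B \in unitmx by rewrite unitmx_mul unitmx_inv uA.
have HA v : s * sqn v <= `|kappa| * sqn (A^T *m v).
  have := wc v; rewrite -/s -sqnE -AS quadratic_form_sqn => /le_trans; apply.
  by rewrite ler_wpM2r ?sqn_ge0// ler_norm.
have HB v : s * sqn (B *m v) <= `|kappa| * s0 * sqn v.
  rewrite -mulmxA; apply: le_trans (sqn_invmx_le uA spos (normr_ge0 _) HA _) _.
  by rewrite -mulrA ler_wpM2l// sqn_mulmx_le.
have HB' v : sqn (A0 *m v) <= s * sqn (B *m v).
  by rewrite -AB -mulmxA /s -AS sqn_mulmx_le.
have HK v : sqn v <= K0 * sqn (A0 *m v).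
  by rewrite -{1}[v](mulKmx uA0) sqn_mulmx_le.
(* The natural size of B is s^(-1/2); the cruder b1 / s is admissible since s < 1 <= b1, and needs
   no square root. Its m-th power is the tr(S)^-m of the bound. *)
have := @tail_comparison _ _ _ _ _ _ _ _ A A0 B (b1 / s) rho (- (rho / 4 / s))
  NZ NZ0 wd0 AB uB (divr_gt0 b10 spos).
rewrite -/V => H; apply: le_trans (H _ _) _.
- move=> v; rewrite -(ler_pM2l spos); apply: le_trans (HB v) _.
  rewrite mulrA ler_wpM2r ?sqn_ge0//.
  have -> : s * (b1 / s) ^+ 2 = b1 ^+ 2 / s by field; rewrite gt_eqF.
  rewrite ler_pdivlMr//; apply: (@le_trans _ _ b1).
    apply: (@le_trans _ _ (`|kappa| * s0)); last by rewrite lerDl.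
    by rewrite ler_piMr ?mulr_ge0// ltW.
  by rewrite expr2 ler_peMl ?(ltW b10)// lerDr mulr_ge0.
- move=> v rv; rewrite ler_pdivrMr// mulNr lerNr.
  rewrite -(ler_pM2l spos); have := HK v; have := HB' v.
  have -> : s * (rho / 4 / s * 2) = rho / 2 by field; rewrite gt_eqF.
  have h1 : s * sqn v <= s * (K0 * sqn (A0 *m v)) by rewrite ler_pM2l.
  have h2 : 2 * K0 * s * sqn (A0 *m v) <= sqn (A0 *m v).
    by rewrite ler_piMl ?sqn_ge0//; lra.
  lra.
have K (x y z t : R) : x * y * z * t = x * t * (y * z) by ring.
by rewrite lee_fin expr_div_n K.
Qed.

(** The same [Z] is used with [A] replaced by c A: [B] is scalar, so no condition number enters, and
    c^2 S has trace e for every S, which keeps it in the neighbourhood where the covariance is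
    bounded. *)
Lemma tail_bounded_near0 (rho : R) : covariance_bounded_near0 theta -> 0 < rho ->
  exists G s1 : R, [/\ 0 <= G, 0 < s1 &
    forall S : 'M[R]_m, [set: 'M[R]_m] S -> posdef S -> 0 < \tr S ->
      \tr S < s1 ->
    forall d (T : measurableType d) (P : probability T R) (A : 'M[R]_m)
      (Z : 'I_m -> {RV P >-> R}),
    A *m A^T = S -> standard_normals Z ->
    covariance_well_defined P (theta \o (fun w => A *m rv_col Z w)) ->
    (\int[P]_w (tail_sqn theta rho (A *m rv_col Z w))%:E <=
     (G * ((\tr S) ^- m * expR (- (rho / 4 / \tr S))))%:E)%E].
Proof.
move=> [M /nbhs_norm0P[del /= del0 Hdel]] rho0.
pose e := del / 2.
have e0 : 0 < e by rewrite divr_gt0.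
(* s < e / 2 means c^2 > 2, so (1 - c^2) / 2 <= - c^2 / 4, and on the tail rho < c^2 |A z|^2 <= e
   |z|^2 = s c^2 |z|^2. In [G], e^m comes from c^m <= (e / s)^m, and m |M| bounds the trace of the
   covariance. *)
exists (e ^+ m * (m%:R * `|M|)), (Num.min (e / 2) 1); split.
- by rewrite !mulr_ge0 ?exprn_ge0 ?(ltW e0).
- by rewrite lt_min ltr01 andbT; exact: divr_gt0.
move=> S _ pS; set s := \tr S => spos; rewrite lt_min => /andP[se s1].
move=> d T P A Z AS NZ _.
pose c := Num.sqrt (e / s).
have es : 2 < e / s by rewrite ltr_pdivlMr// mulrC; lra.
have c2 : c ^+ 2 = e / s by rewrite sqr_sqrtr// ltW// (lt_trans _ es).
have c1 : 1 < c.
  rewrite -(@ltr_pXn2r _ 2) ?nnegrE ?sqrtr_ge0// c2 expr1n; lra.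
have c0 : 0 < c by exact: lt_trans c1.
have symS : S^T = S by case: pS.
pose S' := c ^+ 2 *: S.
have pS' : posdef S'.
  split; first by rewrite /S' linearZ/= symS.
  move=> v v0; rewrite /S' -scalemxAr -scalemxAl mxE mulr_gt0 ?exprn_gt0//.
  by case: pS => _; apply.
have S'small : `|S'| < del.
  rewrite /S' normrZ gtr0_norm ?exprn_gt0// c2.
  apply: (@le_lt_trans _ _ (e / s * s)).
    apply: ler_wpM2l; first by rewrite divr_ge0 ?ltW.
    by rewrite /s -AS gram_norm_le_trace.
  by rewrite divfK ?gt_eqF// /e ltr_pdivrMr// mulr_natr mulr2n ltrDl.
have gauss : gaussian_vector P S' (fun w => (c *: A) *m rv_col Z w).
  exists (c *: A), Z; split => //.
  by rewrite linearZ/= -scalemxAl -scalemxAr scalerA -expr2 AS.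
have [wd cov_le] := Hdel S' S'small pS' _ _ _ _ gauss.
have := @tail_comparison _ _ _ _ _ _ _ _ A (c *: A) c%:M c rho
  (- (rho / 4 / s)) NZ NZ wd.
set V := \tr _ => H.
have VM : V <= m%:R * `|M|.
  apply: (@le_trans _ _ (\sum_(k < m) `|M|)).
    apply: ler_sum => k _; apply: le_trans (ler_norm _) _.
    by apply: le_trans (mx_entry_le_norm _ _ _) _; rewrite (le_trans cov_le)// ler_norm.
  by rewrite sumr_const card_ord -[leLHS]mulr_natr mulrC.
have V0 : 0 <= V.
  rewrite -lee_fin -(expectation_sqn_well_defined wd).
  by apply: integral_ge0 => w _; rewrite lee_fin sqn_ge0.
apply: le_trans (H _ _ c0 _ _) _.
- by rewrite mul_mx_scalar.
- by rewrite unitmxE det_scalar unitrX// unitfE gt_eqF.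
- by move=> v; rewrite mul_scalar_mx sqnZ.
- move=> v; rewrite -scalemxAl sqnZ mul_scalar_mx sqnZ c2 => rv.
  have Av : sqn (A *m v) <= s * sqn v by rewrite /s -AS sqn_mulmx_le.
  rewrite ler_pdivrMr// mulNr lerNr -(ler_pM2l spos).
  have -> : s * (rho / 4 / s * 2) = rho / 2 by field; rewrite gt_eqF.
  have es0 : 0 <= e / s by rewrite divr_ge0 ?ltW.
  have h1 : rho <= e * sqn v.
    apply: (le_trans (ltW rv)); apply: le_trans (ler_wpM2l es0 Av) _.
    by rewrite mulrA divfK ?gt_eqF.
  have -> : s * - (sqn v - e / s * sqn v) = e * sqn v - s * sqn v.
    by field; rewrite gt_eqF.
  have h2 : s * sqn v <= e / 2 * sqn v by rewrite ler_wpM2r ?sqn_ge0// ltW.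
  lra.
rewrite lee_fin; have cm : c ^+ m <= (e / s) ^+ m.
  rewrite -c2 lerXn2r ?nnegrE ?exprn_ge0 ?(ltW c0)//.
  by rewrite expr2 ler_peMl ?ltW.
apply: (@le_trans _ _ ((e / s) ^+ m * expR (- (rho / 4 / s)) * (m%:R * `|M|))).
  apply: ler_pM => //; first by rewrite mulr_ge0 ?expR_ge0 ?exprn_ge0 ?(ltW c0).
  by rewrite ler_wpM2r ?expR_ge0.
by rewrite expr_div_n [leRHS]mulrAC -!mulrA.
Qed.

End tails.

Theorem theorem3p1 (R : realType) (m : nat)
    (theta : 'cV[R]_m -> 'cV[R]_m)
    (theta_analytic : analytic theta) (theta0 : theta 0 = 0) :
  (forall kappa : R,
     covariance_expansion_on theta [set S | well_conditioned kappa S]) /\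
  (covariance_bounded_near0 theta ->
     covariance_expansion_on theta [set: 'M[R]_m]).
Proof.
split => [kappa|bounded]; apply: expansion_of_tail => // rho rho0.
  exact: tail_well_conditioned.
exact: tail_bounded_near0.
Qed.
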